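(* Let $\Bbbk$ be a field, let $t\ge 1$ and $n\ge 1$ be integers, and let $q\in\Bbbk^*$ be not a root of unity. Then every $\Bbbk$-algebra endomorphism of the $n$-fold tensor product $\mathscr{H}_q^t\otimes\cdots\otimes\mathscr{H}_q^t$ (over $\Bbbk$) is an automorphism.
   Context: For $q\in\Bbbk^*$ not a root of unity and an integer $t\ge1$, $\mathscr{H}_q^t$ is the $\Bbbk$-algebra generated by $\Omega,\Omega^{-1},\Psi,\Psi^{\dagger}$ subject to the relations $\Omega\Omega^{-1}=\Omega^{-1}\Omega=1$, $\Psi\Omega=q\Omega\Psi$, $\Psi^{\dagger}\Omega=q^{-1}\Omega\Psi^{\dagger}$, $\Psi\Psi^{\dagger}=\dfrac{q^t\Omega^t-q^{-t}\Omega^{-t}}{q^t-q^{-t}}$ and $\Psi^{\dagger}\Psi=\dfrac{\Omega^t-\Omega^{-t}}{q^t-q^{-t}}$. *)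

(* Defs.v *)
From HB Require Import structures.
From mathcomp Require Import all_boot all_order all_algebra.
Set Implicit Arguments. Unset Strict Implicit. Unset Printing Implicit Defensive.
Import Order.TTheory GRing.Theory Num.Theory.
Local Open Scope ring_scope.

Definition not_root_of_unity (K : fieldType) (q : K) : Prop :=
  forall m : nat, (0 < m)%N -> q ^+ m != 1.

(* The defining relations of H_q^t on elements O (= Omega), Oi (= Omega^-1),
   P (= Psi), Pd (= Psi^dagger) of a K-algebra B. *)
Definition H_rels (K : fieldType) (q : K) (t : nat) (B : algType K)
    (O Oi P Pd : B) : Prop :=
  [/\ O * Oi = 1 /\ Oi * O = 1,
      P * O = q *: (O * P),
      Pd * O = q^-1 *: (O * Pd),
      P * Pd = (q ^+ t - q ^- t)^-1 *: (q ^+ t *: O ^+ t - q ^- t *: Oi ^+ t)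
    & Pd * P = (q ^+ t - q ^- t)^-1 *: (O ^+ t - Oi ^+ t)].

Definition gens (K : fieldType) (B : algType K) (n : nat)
    (O Oi P Pd : 'I_n -> B) (i : 'I_n) : seq B :=
  [:: O i; Oi i; P i; Pd i].

Definition Hn_rels (K : fieldType) (q : K) (t n : nat) (B : algType K)
    (O Oi P Pd : 'I_n -> B) : Prop :=
  (forall i, H_rels q t (O i) (Oi i) (P i) (Pd i)) /\
  (forall i j : 'I_n, i != j -> forall x y : B,
      x \in gens O Oi P Pd i -> y \in gens O Oi P Pd j -> x * y = y * x).

(* (A; O, Oi, P, Pd) is the K-algebra presented by the generators and the
   relations Hn_rels, i.e. the n-fold tensor product of H_q^t: it satisfies
   the relations and has the universal property of the presentation. *)
Definition is_Hn_tensor (K : fieldType) (q : K) (t n : nat) (A : algType K)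
    (O Oi P Pd : 'I_n -> A) : Prop :=
  Hn_rels q t O Oi P Pd /\
  forall (B : algType K) (O' Oi' P' Pd' : 'I_n -> B),
    Hn_rels q t O' Oi' P' Pd' ->
    (exists f : {lrmorphism A -> B},
        forall i, [/\ f (O i) = O' i, f (Oi i) = Oi' i,
                      f (P i) = P' i & f (Pd i) = Pd' i]) /\
    (forall f g : {lrmorphism A -> B},
        (forall i, [/\ f (O i) = g (O i), f (Oi i) = g (Oi i),
                       f (P i) = g (P i) & f (Pd i) = g (Pd i)]) ->
        f =1 g).

(* Main.v *)
(* Sending Omega_i to multiplication by q^(k_i), Psi_i to the shift k -> k + e_i and
   Psi_i^dagger to a weighted shift back realises the algebra A by operators on functions
   on Z^n, inside a quantum torus spanned by independent, skew-multiplicative monomials.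
   Comparing leading terms for a lexicographic order, the torus has no zero divisors and
   its units are monomials; hence A embeds in it, and the units of A are the c * Omega^a.
   For an endomorphism f this gives f(Omega_i) = lam_i Omega^(M_i).  A is graded by Z^n
   through conjugation by the Omega_j, and the commutation relations force f(Psi_i) and
   f(Psi_i^dagger) to be homogeneous of degrees d_i and -d_i, where (d_i) is dual to (M_i).
   Elements whose degree has a negative j-th coordinate kill functions at the points with
   k_j = 0; applied to f(Psi_i^dagger Psi_i) or f(Psi_i Psi_i^dagger) this leaves only
   M_i = d_i = e_j or M_i = d_i = -e_j.  Then f is, up to units, a signed permutation of
   the generators, hence surjective; injectivity follows from the grading and from the
   absence of zero divisors. *)
Require Import Defs.
From HB Require Import structures.
From mathcomp Require Import all_boot all_order all_algebra.
From mathcomp Require Import boolp zify ring.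
Set Implicit Arguments. Unset Strict Implicit. Unset Printing Implicit Defensive.
Import Order.TTheory GRing.Theory Num.Theory.
Local Open Scope ring_scope.

(** * The algebra of linear endomorphisms of a function space *)

Section FunctionEndomorphisms.
Variables (K : fieldType) (X : zmodType).

(** Functions [X -> K] stay bare, so that an operator can be applied to a function and then to a
    point by plain computation. *)
Definition fun_linear (F : (X -> K) -> X -> K) : Prop :=
  forall (c : K) (g h : X -> K),
    F (fun k => c * g k + h k) = (fun k => c * F g k + F h k).

Record fun_end := FunEnd { fun_app :> (X -> K) -> X -> K;
                           fun_app_linear : fun_linear fun_app }.

Lemma fun_endP (F H : fun_end) : (forall g k, F g k = H g k) -> F = H.
Proof.
case: F H => [F lF] [H lH] /= FH.
have E : F = H by apply/funext => g; apply/funext => k.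
by case: _ / E lH => lH; congr FunEnd; apply: Prop_irrelevance.
Qed.

HB.instance Definition _ := gen_eqMixin fun_end.
HB.instance Definition _ := gen_choiceMixin fun_end.

Let linE (F : fun_end) c g h : F (fun k => c * g k + h k) = (fun k => c * F g k + F h k).
Proof. exact: fun_app_linear. Qed.

Lemma fun_end_zero_subproof : fun_linear (fun _ _ => 0).
Proof. by move=> c g h; apply/funext => k; rewrite mulr0 addr0. Qed.
Lemma fun_end_opp_subproof (F : fun_end) : fun_linear (fun g k => - F g k).
Proof. by move=> c g h; apply/funext => k; rewrite linE opprD mulrN. Qed.
Lemma fun_end_add_subproof (F H : fun_end) : fun_linear (fun g k => F g k + H g k).
Proof. by move=> c g h; apply/funext => k; rewrite !linE mulrDr addrACA. Qed.
Lemma fun_end_one_subproof : fun_linear (fun g => g).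
Proof. by []. Qed.
Lemma fun_end_mul_subproof (F H : fun_end) : fun_linear (fun g => F (H g)).
Proof. by move=> c g h; rewrite !linE. Qed.
Lemma fun_end_scale_subproof (a : K) (F : fun_end) : fun_linear (fun g k => a * F g k).
Proof. by move=> c g h; apply/funext => k; rewrite linE mulrDr mulrCA. Qed.

Definition fun_end_zero := FunEnd fun_end_zero_subproof.
Definition fun_end_opp F := FunEnd (fun_end_opp_subproof F).
Definition fun_end_add F H := FunEnd (fun_end_add_subproof F H).
Definition fun_end_one := FunEnd fun_end_one_subproof.
Definition fun_end_mul F H := FunEnd (fun_end_mul_subproof F H).
Definition fun_end_scale a F := FunEnd (fun_end_scale_subproof a F).

Let end_addA : associative fun_end_add.
Proof. by move=> F G H; apply: fun_endP => g k /=; rewrite addrA. Qed.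
Let end_addC : commutative fun_end_add.
Proof. by move=> F G; apply: fun_endP => g k /=; rewrite addrC. Qed.
Let end_add0 : left_id fun_end_zero fun_end_add.
Proof. by move=> F; apply: fun_endP => g k /=; rewrite add0r. Qed.
Let end_addN : left_inverse fun_end_zero fun_end_opp fun_end_add.
Proof. by move=> F; apply: fun_endP => g k /=; rewrite addNr. Qed.
HB.instance Definition _ := GRing.isZmodule.Build fun_end end_addA end_addC end_add0 end_addN.

Let end_mulA : associative fun_end_mul.
Proof. by move=> F G H; apply: fun_endP. Qed.
Let end_mul1l : left_id fun_end_one fun_end_mul.
Proof. by move=> F; apply: fun_endP. Qed.
Let end_mul1r : right_id fun_end_one fun_end_mul.
Proof. by move=> F; apply: fun_endP. Qed.
Let end_mulDl : left_distributive fun_end_mul fun_end_add.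
Proof. by move=> F G H; apply: fun_endP. Qed.
Let end_mulDr : right_distributive fun_end_mul fun_end_add.
Proof.
move=> F G H; apply: fun_endP => g k /=.
have -> : (fun k => G g k + H g k) = (fun k => 1 * G g k + H g k).
  by apply/funext => k'; rewrite mul1r.
by rewrite linE mul1r.
Qed.
Let end_oner0 : fun_end_one != 0.
Proof.
apply/eqP => /(congr1 (fun F : fun_end => F (fun _ => 1) 0)) /eqP.
by rewrite /= oner_eq0.
Qed.
HB.instance Definition _ :=
  GRing.Zmodule_isNzRing.Build fun_end
    end_mulA end_mul1l end_mul1r end_mulDl end_mulDr end_oner0.

Let end_scaleA a b F : fun_end_scale a (fun_end_scale b F) = fun_end_scale (a * b) F.
Proof. by apply: fun_endP => g k /=; rewrite mulrA. Qed.
Let end_scale1 : left_id 1 fun_end_scale.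
Proof. by move=> F; apply: fun_endP => g k /=; rewrite mul1r. Qed.
Let end_scaleDr : right_distributive fun_end_scale +%R.
Proof. by move=> a F H; apply: fun_endP => g k /=; rewrite mulrDr. Qed.
Let end_scaleDl F : {morph fun_end_scale^~ F : a b / a + b}.
Proof. by move=> a b; apply: fun_endP => g k /=; rewrite mulrDl. Qed.
HB.instance Definition _ :=
  GRing.Zmodule_isLmodule.Build K fun_end end_scaleA end_scale1 end_scaleDr end_scaleDl.

Let end_scaleAl a (F H : fun_end) : a *: (F * H) = a *: F * H.
Proof. by apply: fun_endP. Qed.
HB.instance Definition _ := GRing.Lmodule_isLalgebra.Build K fun_end end_scaleAl.

Let end_scaleAr a (F H : fun_end) : a *: (F * H) = F * (a *: H).
Proof.
apply: fun_endP => g k /=.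
have -> : (fun k => a * H g k) = (fun k => a * H g k + 0).
  by apply/funext => k'; rewrite addr0.
(* [linE] leaves an extra summand, the image of the zero function; additivity makes this image equal
   to its own double, hence zero. *)
rewrite linE -[LHS]addr0; congr (_ + _); symmetry.
have E : (fun _ : X => 1 * 0 + 0 : K) = (fun _ => 0).
  by apply/funext => k'; rewrite mulr0 addr0.
have /(congr1 (fun G : X -> K => G k)) := linE F 1 (fun _ => 0) (fun _ => 0).
by rewrite E mul1r => /eqP; rewrite -subr_eq subrr eq_sym => /eqP.
Qed.
HB.instance Definition _ := GRing.Lalgebra_isAlgebra.Build K fun_end end_scaleAr.

End FunctionEndomorphisms.

(** * Subalgebras as algebras in their own right *)

Section SubalgebraType.
Variables (K : fieldType) (A : algType K) (S : subalgClosed A).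

Definition subalg_sort := {x : A | x \in S}.
HB.instance Definition _ := SubType.on subalg_sort.
HB.instance Definition _ := [Choice of subalg_sort by <:].
HB.instance Definition _ := [SubChoice_isSubAlgebra of subalg_sort by <:].


(** The inclusion gets its own name, on which the multiplicative and the linear structure are both
    registered, so that it can serve as an [{lrmorphism}]. *)
Definition subalg_val : subalg_sort -> A := val.
HB.instance Definition _ := GRing.RMorphism.copy subalg_val (val : subalg_sort -> A).
HB.instance Definition _ := GRing.Linear.copy subalg_val (val : subalg_sort -> A).
End SubalgebraType.

(** * Induction on the generators *)

(** The elements satisfying [Q], decided classically, form a subalgebra [S] containing the
    generators. The universal property gives a morphism from [A] to [S]; followed by the inclusion
    it fixes the generators, so by uniqueness it is the identity, and every [x] lies in [S]. *)
Lemma Hn_tensor_ind (K : fieldType) (q : K) (t n : nat) (A : algType K)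
    (O Oi P Pd : 'I_n -> A) (Q : A -> Prop) :
  is_Hn_tensor q t O Oi P Pd ->
  Q 1 -> (forall c x y, Q x -> Q y -> Q (c *: x + y)) ->
  (forall x y, Q x -> Q y -> Q (x * y)) ->
  (forall i, [/\ Q (O i), Q (Oi i), Q (P i) & Q (Pd i)]) ->
  forall x, Q x.
Proof.
move=> [[relA commA] univA] Q1 QL QM Qgen x.
have [S QP] : exists S : subalgClosed A, forall y, y \in S <-> Q y.
  pose Qp : {pred A} := fun y => `[<Q y>].
  have QpP y : reflect (Q y) (y \in Qp) by apply: asboolP.
  have Qclosed : subalg_closed Qp.
    split=> [|c y z /QpP Qy /QpP Qz|y z /QpP Qy /QpP Qz]; apply/QpP => //.
    - exact: QL.
    - exact: QM.
  exists (HB.pack_for (subalgClosed A) Qp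
    (GRing.isSubalgClosed.Build K A Qp (GRing.subalg_closed_semi Qclosed))) => y.
  by split=> /QpP.
pose lift y (Qy : Q y) : subalg_sort S := Sub y (proj2 (QP y) Qy).
have gO i : Q (O i) by case: (Qgen i).
have gOi i : Q (Oi i) by case: (Qgen i).
have gP i : Q (P i) by case: (Qgen i).
have gPd i : Q (Pd i) by case: (Qgen i).
have [v [vI vE vS]] : exists v : {lrmorphism subalg_sort S -> A},
    [/\ injective v, forall y Qy, v (lift y Qy) = y & forall s, v s \in S].
  exists (@subalg_val _ _ S); split=> [|//|s]; first exact: val_inj.
  exact: valP s.
have relS : Hn_rels q t (fun i => lift _ (gO i)) (fun i => lift _ (gOi i))
    (fun i => lift _ (gP i)) (fun i => lift _ (gPd i)).
  split=> [i|i j ij y z yi zj].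
    case: (relA i) => -[r1 r2] r3 r4 r5 r6.
    split; [split|..]; apply: vI.
    - by rewrite rmorphM rmorph1 /= !vE.
    - by rewrite rmorphM rmorph1 /= !vE.
    - by rewrite linearZ !rmorphM /= !vE.
    - by rewrite linearZ !rmorphM /= !vE.
    - rewrite linearZ /= rmorphB /= linearZ /= [v (q ^- t *: _)]linearZ /=.
      by rewrite !rmorphXn rmorphM /= !vE.
    - by rewrite linearZ /= rmorphB /= !rmorphXn rmorphM /= !vE.
  apply: vI; rewrite !rmorphM; apply: (commA i j ij).
    by move: yi; rewrite !inE => /or4P[]/eqP->; rewrite /= vE ?inE ?eqxx ?orbT.
  by move: zj; rewrite !inE => /or4P[]/eqP->; rewrite /= vE ?inE ?eqxx ?orbT.
have [[f fE] _] := univA _ _ _ _ _ relS.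
have [_ uniqA] := univA A _ _ _ _ (conj relA commA).
pose g : {lrmorphism A -> A} := v \o f.
have := uniqA g idfun _ x; rewrite /= => <-.
  exact: proj1 (QP _) (vS (f x)).
by move=> i; rewrite /g /=; case: (fE i) => -> -> -> ->; rewrite /= !vE.
Qed.

(** * Linear independence of eigenvectors and finite sums *)

(* The conjugation by an invertible element is encoded without its inverse:
   [T i] and [U i] are meant to be multiplications on opposite sides. *)
Lemma eigen_indep (K : fieldType) (V W : lmodType K) (D : eqType) (I : Type)
    (T U : I -> {linear V -> W}) (chi : I -> D -> K) (s : seq D) (y : D -> V) :
  uniq s ->
  (forall i d, T i (y d) = chi i d *: U i (y d)) ->
  (forall i v, U i v = 0 -> v = 0) ->
  (forall d e, d != e -> exists i, chi i d != chi i e) ->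
  \sum_(d <- s) y d = 0 -> forall d, d \in s -> y d = 0.
Proof.
move=> us yE U0 sep; elim: s us y yE => [//|d0 s IH] /= /andP[d0s us] y yE sum0.
have ys0 d : d \in s -> y d = 0.
  move=> ds; have [|i chiNe] := sep d d0; first by apply: contraNneq d0s => <-.
  suff /eqP : (chi i d - chi i d0) *: y d = 0.
    by rewrite scaler_eq0 subr_eq0 (negPf chiNe) => /eqP.
  (* Apply [T i] to the relation and subtract [chi i d0] times its image under [U i]: the [d0] term
     cancels, leaving a shorter relation between eigenvectors. *)
  apply: (IH us (fun e => (chi i e - chi i d0) *: y e)) => // [j e|].
    by rewrite !linearZ /= yE !scalerA mulrC.
  apply: (U0 i); have := congr1 (T i) sum0.
  rewrite big_cons linearD linear0 /= yE linear_sum /=.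
  move=> /(congr1 (fun z => z - chi i d0 *: U i (\sum_(e <- d0 :: s) y e))).
  rewrite {2}sum0 linear0 scaler0 subr0 => sumE; rewrite -[RHS]sumE.
  rewrite big_cons linearD scalerDr opprD addrACA subrr add0r !linear_sum.
  rewrite -big_split; apply: eq_bigr => e _ /=.
  by rewrite linearZ /= scalerBl yE.
move=> d; rewrite inE => /orP[/eqP->|]; last exact: ys0.
move: sum0; rewrite big_cons big_seq big1 ?addr0 // => e; exact: ys0.
Qed.

Section FiniteSums.
Variables (V : zmodType) (D : eqType) (Q : D -> V -> Prop).
Hypotheses (Q0 : forall d, Q d 0) (QB : forall d x y, Q d x -> Q d y -> Q d (x - y)).

(** [P] bounds the support. The family [a] is total and vanishes off [s], so that two sums can be
    rewritten over one common list. *)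
Definition fsum (P : D -> Prop) (x : V) : Prop :=
  exists (s : seq D) (a : D -> V),
    [/\ uniq s, forall d, Q d (a d), forall d, a d != 0 -> P d /\ d \in s
      & x = \sum_(d <- s) a d].

Lemma sum_widen (s s' : seq D) (a : D -> V) :
  uniq s -> uniq s' -> (forall d, a d != 0 -> d \in s) ->
  {subset s <= s'} -> \sum_(d <- s) a d = \sum_(d <- s') a d.
Proof.
move=> us us' aS ss'; rewrite [RHS](bigID (mem s)) /= [X in _ + X]big1 ?addr0.
  rewrite -[RHS]big_filter; apply/perm_big/uniq_perm; rewrite ?filter_uniq //.
  by move=> d; rewrite mem_filter; case: (boolP (d \in s)) => // /ss'.
by move=> d; apply: contraNeq => /aS.
Qed.

Lemma fsum0 P : fsum P 0.
Proof.
exists [::], (fun _ => 0); split=> // [d|]; first by rewrite eqxx.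
by rewrite big_nil.
Qed.

Lemma fsum1 (P : D -> Prop) d x : Q d x -> P d -> fsum P x.
Proof.
move=> Qx Pd; exists [:: d], (fun e => if e == d then x else 0); split=> //.
- by move=> e; case: (e =P d) => [->|_].
- by move=> e; case: (e =P d) => [->|_]; rewrite ?mem_head ?eqxx.
- by rewrite big_seq1 eqxx.
Qed.

Lemma fsum_sub (P P' : D -> Prop) x : (forall d, P d -> P' d) -> fsum P x -> fsum P' x.
Proof.
move=> PP' [s [a [us Qa aP xE]]]; exists s, a; split=> // d /aP[/PP' Pd ds].
by split.
Qed.

Lemma fsum_pair P P' x y : fsum P x -> fsum P' y ->
  exists (s : seq D) (a b : D -> V), [/\ uniq s, forall d, Q d (a d) /\ Q d (b d),
    forall d, a d != 0 -> P d, forall d, b d != 0 -> P' d &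
    [/\ forall d, d \notin s -> a d = 0 /\ b d = 0, x = \sum_(d <- s) a d
      & y = \sum_(d <- s) b d]].
Proof.
move=> [s [a [us Qa aP xE]]] [s' [b [us' Qb bP yE]]].
exists (undup (s ++ s')), a, b; split; first exact: undup_uniq.
- by [].
- by move=> d /aP[].
- by move=> d /bP[].
split.
- move=> d; rewrite mem_undup mem_cat negb_or => /andP[ds ds'].
  by split; apply/eqP; [apply: contraNT ds => /aP[]|apply: contraNT ds' => /bP[]].
- rewrite xE; apply: sum_widen; rewrite ?undup_uniq // => d; first by case/aP.
  by rewrite mem_undup mem_cat => ->.
- rewrite yE; apply: sum_widen; rewrite ?undup_uniq // => d; first by case/bP.
  by rewrite mem_undup mem_cat orbC => ->.
Qed.

Lemma fsumB P x y : fsum P x -> fsum P y -> fsum P (x - y).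
Proof.
move=> Px Py; have [s [a [b [us Qab aP bP [out -> ->]]]]] := fsum_pair Px Py.
exists s, (fun d => a d - b d); rewrite sumrB; split=> // d.
  by case: (Qab d); apply: QB.
have [->|a0] := eqVneq (a d) 0 => [b0|_]; split.
- by apply: bP; apply: contraNneq b0 => ->; rewrite subr0.
- by apply: contraNT b0 => /out[_ ->]; rewrite subr0.
- exact: aP.
- by apply: contraNT a0 => /out[->].
Qed.

Lemma fsumN P x : fsum P x -> fsum P (- x).
Proof. by rewrite -sub0r; apply: fsumB; apply: fsum0. Qed.

Lemma fsumD P x y : fsum P x -> fsum P y -> fsum P (x + y).
Proof. by move=> Px /fsumN Py; rewrite -[y]opprK; apply: fsumB. Qed.

Lemma fsum_ind P (R : V -> Prop) : R 0 -> (forall x y, R x -> R y -> R (x + y)) ->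
  (forall d x, Q d x -> P d -> R x) -> forall x, fsum P x -> R x.
Proof.
move=> R0 RD R1 x [s [a [_ Qa aP ->]]].
elim: s {aP} (fun d a0 => proj1 (aP d a0)) => [|d s IH] aP; first by rewrite big_nil.
rewrite big_cons; apply: RD (IH aP).
by have [->//|/aP] := eqVneq (a d) 0; apply: R1.
Qed.

Hypothesis Q_indep : forall (s : seq D) (a : D -> V), uniq s -> (forall d, Q d (a d)) ->
  \sum_(d <- s) a d = 0 -> forall d, d \in s -> a d = 0.

(** Over a common list, independence makes the two expansions agree term by term, so the index of a
    nonzero term would satisfy both [P] and [P']. *)
Lemma fsum_disjoint P P' x :
  fsum P x -> fsum P' x -> (forall d, P d -> P' d -> False) -> x = 0.
Proof.
move=> Px P'x PP'; have [s [a [b [us Qab aP bP [out xE xE']]]]] := fsum_pair Px P'x.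
rewrite xE big_seq big1 // => d ds; apply/eqP/negPn/negP => a0.
suff ab : a d = b d by apply: (PP' d); [apply: aP | apply: bP; rewrite -ab].
apply/eqP; rewrite -subr_eq0; apply/eqP.
apply: (@Q_indep s (fun d => a d - b d) us) => // [e|].
  by case: (Qab e); apply: QB.
by rewrite sumrB -xE -xE' subrr.
Qed.

End FiniteSums.

Lemma fsumM (K : fieldType) (B : algType K) (D : zmodType) (Q : D -> B -> Prop)
    (P P' P'' : D -> Prop) x y :
  (forall d, Q d 0) -> (forall d x y, Q d x -> Q d y -> Q d (x - y)) ->
  (forall d e x y, Q d x -> Q e y -> Q (d + e) (x * y)) ->
  (forall d e, P d -> P' e -> P'' (d + e)) ->
  fsum Q P x -> fsum Q P' y -> fsum Q P'' (x * y).
Proof.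
move=> Q0 QB QM PP' Px Py.
elim/fsum_ind: x / Px => [|x x' Ix Ix'|d x Qx Pd].
- by rewrite mul0r; apply: fsum0.
- by rewrite mulrDl; apply: fsumD.
elim/fsum_ind: y / Py => [|y y' Iy Iy'|e y Qy Pe].
- by rewrite mulr0; apply: fsum0.
- by rewrite mulrDr; apply: fsumD.
by apply: (@fsum1 _ _ _ Q0 _ (d + e)); [apply: QM|apply: PP'].
Qed.

(** * Leading terms in a skew group algebra *)

Section LeadingTerms.
Variables (K : fieldType) (B : algType K) (D : zmodType) (E : D -> B).
Hypothesis E0 : E 0 = 1.
Hypothesis EM : forall d e, exists2 c : K, c != 0 & E d * E e = c *: E (d + e).

Definition in_line (d : D) (x : B) := exists c : K, x = c *: E d.

Lemma in_line0 d : in_line d 0.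
Proof. by exists 0; rewrite scale0r. Qed.

Lemma in_lineB d x y : in_line d x -> in_line d y -> in_line d (x - y).
Proof. by move=> [c ->] [c' ->]; exists (c - c'); rewrite scalerBl. Qed.

Lemma in_lineM d e x y : in_line d x -> in_line e y -> in_line (d + e) (x * y).
Proof.
move=> [c ->] [c' ->]; have [b _ bE] := EM d e; exists (c * c' * b).
by rewrite -scalerAr -scalerAl bE !scalerA [c' * c]mulrC.
Qed.

Lemma in_lineE d c : in_line d (c *: E d). Proof. by exists c. Qed.

Hypothesis line_indep : forall (s : seq D) (a : D -> B), uniq s ->
  (forall d, in_line d (a d)) -> \sum_(d <- s) a d = 0 ->
  forall d, d \in s -> a d = 0.

Lemma E_neq0 d : E d != 0.
Proof.
apply/eqP => Ed0; have [c c0] := EM d (- d).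
by rewrite Ed0 mul0r subrr E0 => /esym/eqP; rewrite scaler_eq0 oner_eq0 (negPf c0).
Qed.

Let S := fsum in_line.
Let SD P x y : S P x -> S P y -> S P (x + y).
Proof. exact: (fsumD in_line0 in_lineB). Qed.
Let SB P x y : S P x -> S P y -> S P (x - y).
Proof. exact: (fsumB in_lineB). Qed.
Let S1 (P : D -> Prop) d c : P d -> S P (c *: E d).
Proof. exact: (fsum1 in_line0 (in_lineE d c)). Qed.
Let SM (P P' P'' : D -> Prop) x y : (forall d e, P d -> P' e -> P'' (d + e)) ->
  S P x -> S P' y -> S P'' (x * y).
Proof. exact: (fsumM in_line0 in_lineB in_lineM). Qed.

(** If [P d] failed, [c *: E d] would have two expansions with disjoint supports. As [P] is an
    arbitrary proposition, the conclusion is doubly negated; it is only used to reach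
    contradictions. *)
Lemma line_disjoint (P : D -> Prop) d c : S P (c *: E d) -> c != 0 -> ~ ~ P d.
Proof.
move=> Sx c0 Pd; have : c *: E d = 0.
  apply: (fsum_disjoint in_lineB line_indep Sx (S1 c (erefl d))) => e Pe ed.
  by apply: Pd; rewrite ed.
by apply/eqP; rewrite scaler_eq0 negb_or c0 E_neq0.
Qed.

(** Here [e] counts as smaller than [d] when [pos (d - e)]. The sign [pos] is a parameter because
    the reversed order is used too, to reach lowest terms. *)
Definition leading (pos : pred D) (x : B) (d : D) : Prop :=
  exists2 c : K, c != 0 & S (fun e => pos (d - e)) (x - c *: E d).

Section Order.
Variable pos : pred D.
Hypotheses (pos0 : ~~ pos 0) (posD : forall d e, pos d -> pos e -> pos (d + e)).
Hypothesis pos_total : forall d, d != 0 -> pos d || pos (- d).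

Lemma exists_max (d0 : D) (s : seq D) :
  exists2 m, m \in d0 :: s & forall e, e \in d0 :: s -> e != m -> pos (m - e).
Proof.
elim: s d0 => [|d s IH] d0.
  by exists d0; rewrite ?mem_head // => e; rewrite inE => ->.
have [m ms mP] := IH d; have [d0m|d0m] := eqVneq d0 m.
  exists m; first by rewrite inE ms orbT.
  by move=> e; rewrite inE => /orP[/eqP->|/mP //]; rewrite d0m eqxx.
have /pos_total/orP[mP0|mN0] : m - d0 != 0 by rewrite subr_eq0 eq_sym.
  exists m; first by rewrite inE ms orbT.
  by move=> e; rewrite inE => /orP[/eqP->|/mP].
exists d0; first by rewrite mem_head.
move=> e; rewrite inE => /orP[/eqP->|es _]; first by rewrite eqxx.
rewrite opprB in mN0; have [->//|em] := eqVneq e m.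
by rewrite -[d0](subrK m) -addrA; apply: posD => //; apply: mP.
Qed.

Lemma leading_exists x : S (fun=> True) x -> x != 0 -> exists d, leading pos x d.
Proof.
move=> [s [a [us Qa _ ->]]] x0.
(* Zero terms are dropped first, so that the maximal index carries a nonzero coefficient. *)
pose s' := [seq d <- s | a d != 0].
have sumE : \sum_(d <- s) a d = \sum_(d <- s') a d.
  by rewrite big_filter [LHS](bigID (fun d => a d == 0)) /= big1 ?add0r // => d /eqP.
have us' : uniq s' by apply: filter_uniq.
have as' d : d \in s' -> a d != 0 by rewrite mem_filter => /andP[].
rewrite sumE in x0 *; case: s' us' as' x0 {sumE} => [|d0 r] us' as' x0.
  by rewrite big_nil eqxx in x0.
have [m] := exists_max d0 r; move: us' as' x0; move: (d0 :: r) => s1.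
move=> us' as' x0 ms mP; exists m; have [c aE] := Qa m.
exists c; first by apply: contraNneq (as' m ms) => c0; rewrite aE c0 scale0r.
rewrite (big_rem m) //= -aE [_ - a m]addrC addKr.
rewrite big_seq; apply: (big_ind (S _)); [exact: (fsum0 in_line0)|exact: SD|].
move=> e; rewrite mem_rem_uniq // inE => /andP[em es].
by apply: (@fsum1 _ _ _ in_line0 _ e (a e)) => //; apply: mP.
Qed.

Lemma leadingM x y d e : leading pos x d -> leading pos y e ->
  leading pos (x * y) (d + e).
Proof.
move=> [c c0 Sx] [c' c'0 Sy]; have [b b0 bE] := EM d e.
exists (c * c' * b); first by rewrite !mulf_neq0.
(* Each of the three products has a factor that is a remainder, so all its indices are strictly
   below [d + e]. *)
rewrite (_ : x * y - _ = (x - c *: E d) * (y - c' *: E e)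
    + ((x - c *: E d) * (c' *: E e) + c *: E d * (y - c' *: E e))).
  have S1' z k : S (fun f => f = z) (k *: E z) := S1 k (erefl z).
  have shift f g : d + e - (f + g) = (d - f) + (e - g) by rewrite opprD addrACA.
  apply: SD; last apply: SD.
  - by apply: SM Sx Sy => f g df eg; rewrite shift posD.
  - by apply: SM Sx (S1' e c') => f g df ->; rewrite shift subrr addr0.
  - by apply: SM (S1' d c) Sy => f g -> eg; rewrite shift subrr add0r.
have -> : (c * c' * b) *: E (d + e) = c *: E d * (c' *: E e).
  by rewrite -scalerAr -scalerAl bE !scalerA [c' * c]mulrC.
by rewrite addrA -mulrDr subrK mulrBl mulrBr addrA subrK.
Qed.

Lemma leading_neq0 x d : leading pos x d -> x != 0.
Proof.
move=> [c c0 Sx]; apply/eqP => x0; rewrite x0 sub0r -scaleNr in Sx.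
by apply: (line_disjoint Sx); rewrite ?oppr_eq0 // subrr; apply/negP.
Qed.

(** Since 1 is [E 0], the term [c *: E d] is [E 0] minus terms strictly below [d]; its own index can
    only be 0. *)
Lemma leading1 d : leading pos 1 d -> d = 0.
Proof.
move=> [c c0 Sx]; apply/eqP/negPn/negP => d0.
have : S (fun e => e = 0 \/ pos (d - e)) (c *: E d).
  have -> : c *: E d = 1 *: E 0 - (1 - c *: E d).
    by rewrite scale1r E0 opprB addrC subrK.
  apply: SB; first by apply: S1; left.
  by apply: fsum_sub Sx => e; right.
move/line_disjoint => /(_ c0); apply => -[/eqP|]; first exact/negP.
by rewrite subrr; apply/negP.
Qed.

End Order.

Variable pos : pred D.
Hypotheses (pos0 : ~~ pos 0) (posD : forall d e, pos d -> pos e -> pos (d + e)).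
Hypothesis pos_total : forall d, d != 0 -> pos d || pos (- d).

Lemma span_domain x y : S (fun=> True) x -> S (fun=> True) y ->
  x * y = 0 -> x = 0 \/ y = 0.
Proof.
move=> Sx Sy xy0; have [->|x0] := eqVneq x 0; first by left.
have [->|y0] := eqVneq y 0; first by right.
have [d xd] := leading_exists posD pos_total Sx x0.
have [e ye] := leading_exists posD pos_total Sy y0.
by have := leading_neq0 pos0 (leadingM posD xd ye); rewrite xy0 eqxx.
Qed.

Let neg d := pos (- d).
Let neg0 : ~~ neg 0. Proof. by rewrite /neg oppr0. Qed.
Let negD d e : neg d -> neg e -> neg (d + e).
Proof. by rewrite /neg opprD; apply: posD. Qed.
Let neg_total d : d != 0 -> neg d || neg (- d).
Proof. by rewrite -oppr_eq0; apply: pos_total. Qed.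

(** With [neg] reversing the order, [d] is the highest and [d'] the lowest index of [x]; the lowest
    cannot exceed the highest. *)
Lemma leading_neg_pos x d d' : leading pos x d -> leading neg x d' ->
  d' = d \/ pos (d - d').
Proof.
move=> [c c0 Sx] [c' c'0 Sx'].
have : S (fun e => e = d \/ (pos (d - e) \/ neg (d' - e))) (c' *: E d').
  have -> : c' *: E d' = c *: E d + (x - c *: E d) - (x - c' *: E d').
    by rewrite addrCA subrr addr0 opprB addrCA subrr addr0.
  apply: SB; last by apply: fsum_sub Sx' => e; right; right.
  apply: SD; first by apply: S1; left.
  by apply: fsum_sub Sx => e; right; left.
move/line_disjoint => /(_ c'0) PP.
have [->|ne] := eqVneq d' d; [by left | right; apply/negPn/negP => np].
apply: PP => -[/eqP|[pd|]]; rewrite ?(negPf ne) // ?pd // in np *.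
by rewrite subrr; apply/negP.
Qed.

(** The highest indices of [x] and [y] add up to 0, and so do the lowest ones. A positive gap
    between the extremes of [x] would therefore be a negative gap for [y]; hence the extremes
    coincide and [x] has a single term. *)
Lemma span_unit x y : S (fun=> True) x -> S (fun=> True) y -> x * y = 1 ->
  exists d, exists2 c, c != 0 & x = c *: E d.
Proof.
move=> Sx Sy xy1.
have x0 : x != 0.
  by apply/eqP => x0; move/eqP: xy1; rewrite x0 mul0r eq_sym oner_eq0.
have y0 : y != 0.
  by apply/eqP => y0; move/eqP: xy1; rewrite y0 mulr0 eq_sym oner_eq0.
have [d xd] := leading_exists posD pos_total Sx x0.
have [e ye] := leading_exists posD pos_total Sy y0.
have [d' xd'] := leading_exists negD neg_total Sx x0.
have [e' ye'] := leading_exists negD neg_total Sy y0.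
have := leadingM posD xd ye; rewrite xy1 => /(leading1 pos0)/eqP.
rewrite addrC addr_eq0 => /eqP eE.
have := leadingM negD xd' ye'; rewrite xy1 => /(leading1 neg0)/eqP.
rewrite addrC addr_eq0 => /eqP e'E.
have dd : d' = d.
  case: (leading_neg_pos xd xd') => // p; case: (leading_neg_pos ye ye').
    by rewrite eE e'E => /oppr_inj.
  rewrite eE e'E opprK => p'; have := posD p p'.
  by rewrite addrACA subrr add0r addNr (negPf pos0).
subst d'; case: xd xd' => c c0 Sc [c' c'0 Sc'].
exists d, c => //; apply/eqP; rewrite -subr_eq0; apply/eqP.
(* The remainder lies strictly below [d] by [Sc] and at or above [d] by this expansion, so it
   vanishes. *)
have Sc'' : S (fun e => e = d \/ neg (d - e)) (x - c *: E d).
  have -> : x - c *: E d = (x - c' *: E d) + (c' - c) *: E d.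
    by rewrite scalerBl addrA subrK.
  apply: SD; first by apply: fsum_sub Sc' => f; right.
  by apply: S1; left.
apply: (fsum_disjoint in_lineB line_indep Sc Sc'') => f pf [fd|nf].
  by move: pf; rewrite fd subrr (negPf pos0).
by have := posD pf nf; rewrite subrr (negPf pos0).
Qed.

End LeadingTerms.

(** * Lexicographic orders on Z^n and on pairs of exponents *)

Section LexicographicSign.
Variable n : nat.
Implicit Types a b : {ffun 'I_n -> int}.

Definition lex_pos a := [exists i, (0 < a i) && [forall j : 'I_n, (j < i)%N ==> (a j == 0)]].

Lemma lex_posP a : reflect
  (exists2 i, 0 < a i & forall j : 'I_n, (j < i)%N -> a j = 0) (lex_pos a).
Proof.
apply: (iffP existsP) => -[i].
  by move=> /andP[ai /forallP aj]; exists i => // j ji; apply/eqP/(implyP (aj j)).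
move=> ai aj; exists i; rewrite ai; apply/forallP => j.
by apply/implyP => /aj ->.
Qed.

Lemma lex_pos0 : ~~ lex_pos 0.
Proof. by apply/lex_posP => -[i]; rewrite ffunE. Qed.

Lemma lex_posD a b : lex_pos a -> lex_pos b -> lex_pos (a + b).
Proof.
move=> /lex_posP[i ai aj] /lex_posP[k bk bj]; apply/lex_posP.
case: (ssrnat.ltngtP i k) => [ik|ki|ik].
- exists i => [|j ji]; rewrite ffunE; first by rewrite (bj i) // addr0.
  by rewrite aj // bj // (ssrnat.ltn_trans ji).
- exists k => [|j jk]; rewrite ffunE; first by rewrite (aj k) // add0r.
  by rewrite bj // aj // (ssrnat.ltn_trans jk).
have {ik} ik : i = k by apply: val_inj.
subst k; exists i => [|j ji]; rewrite ffunE; first exact: addr_gt0.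
by rewrite aj // bj.
Qed.

Lemma lex_pos_total a : a != 0 -> lex_pos a || lex_pos (- a).
Proof.
move=> a0; have /existsP[i0 ai0] : [exists i, a i != 0].
  apply: contraNT a0; rewrite negb_exists => /forallP aP; apply/eqP/ffunP => i.
  by rewrite ffunE; apply/eqP/negPn.
have [i ai imin] := @arg_minnP _ i0 (fun i => a i != 0) val ai0.
have aj (j : 'I_n) : (j < i)%N -> a j = 0.
  by move=> ji; apply/eqP/negPn/negP => /imin; rewrite leqNgt ji.
have [ap|an] : 0 < a i \/ 0 < (- a) i.
  by rewrite ffunE oppr_gt0; apply/orP; rewrite orbC -neq_lt.
  by apply/orP; left; apply/lex_posP; exists i.
by apply/orP; right; apply/lex_posP; exists i => // j /aj; rewrite ffunE => ->.
Qed.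

Definition lex_pos2 (p : {ffun 'I_n -> int} * {ffun 'I_n -> int}) :=
  lex_pos p.1 || (p.1 == 0) && lex_pos p.2.

Lemma lex_pos2_0 : ~~ lex_pos2 0.
Proof. by rewrite /lex_pos2 /= negb_or negb_and lex_pos0 orbT. Qed.

Lemma lex_pos2D p r : lex_pos2 p -> lex_pos2 r -> lex_pos2 (p + r).
Proof.
case: p r => [a d] [b e]; rewrite /lex_pos2 /=.
case/orP=> [pa|/andP[/eqP-> pd]]; case/orP=> [pb|/andP[/eqP-> pe]].
- by rewrite lex_posD.
- by rewrite addr0 pa.
- by rewrite add0r pb.
- by rewrite addr0 eqxx lex_posD // orbT.
Qed.

Lemma lex_pos2_total p : p != 0 -> lex_pos2 p || lex_pos2 (- p).
Proof.
case: p => a d; rewrite /lex_pos2 /= oppr_eq0 => ad0.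
have [a0|/lex_pos_total/orP[->|->]] := eqVneq a 0; rewrite ?orbT //.
have /lex_pos_total/orP[->|->] : d != 0; rewrite ?orbT //.
by apply: contraNneq ad0 => ->; rewrite a0.
Qed.

End LexicographicSign.

(** * The quantum torus and the representation *)

Section Multiplications.
Variables (K : fieldType) (B : algType K) (a : B).

(** Packed as linear maps, [lmul] and [rmul] play the roles of [T] and [U] in [eigen_indep]. *)
Definition lmul (x : B) := a * x.
Fact lmul_is_linear : linear lmul.
Proof. by move=> c x y; rewrite /lmul mulrDr scalerAr. Qed.
HB.instance Definition _ := GRing.isLinear.Build K B B *:%R lmul lmul_is_linear.

Definition rmul (x : B) := x * a.
Fact rmul_is_linear : linear rmul.
Proof. by move=> c x y; rewrite /rmul mulrDl scalerAl. Qed.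
HB.instance Definition _ := GRing.isLinear.Build K B B *:%R rmul rmul_is_linear.

End Multiplications.

(** * The standard pairing on Z^n and induction by unit steps *)

Section Pairing.
Variable n : nat.
Implicit Types a b k : {ffun 'I_n -> int}.

Definition dot a k : int := \sum_i a i * k i.
Definition eps (i : 'I_n) : {ffun 'I_n -> int} := [ffun j => (j == i)%:R].

Lemma dotC a k : dot a k = dot k a.
Proof. by apply: eq_bigr => i _; rewrite mulrC. Qed.

Lemma dotDl a b k : dot (a + b) k = dot a k + dot b k.
Proof. by rewrite /dot -big_split; apply: eq_bigr => i _; rewrite ffunE mulrDl. Qed.

Lemma dotDr a k b : dot a (k + b) = dot a k + dot a b.
Proof. by rewrite ![dot a _]dotC dotDl. Qed.

Lemma dotNl a k : dot (- a) k = - dot a k.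
Proof. by rewrite /dot -sumrN; apply: eq_bigr => i _; rewrite ffunE mulNr. Qed.

Lemma dotNr a k : dot a (- k) = - dot a k.
Proof. by rewrite dotC dotNl dotC. Qed.

Lemma dot0l k : dot 0 k = 0.
Proof. by rewrite /dot big1 // => i _; rewrite ffunE mul0r. Qed.

Lemma dot0r a : dot a 0 = 0. Proof. by rewrite dotC dot0l. Qed.

Lemma dot_epsl i k : dot (eps i) k = k i.
Proof.
rewrite /dot (bigD1 i) //= ffunE eqxx mul1r big1 ?addr0 // => j ji.
by rewrite ffunE (negPf ji) mul0r.
Qed.

Lemma dot_epsr i a : dot a (eps i) = a i. Proof. by rewrite dotC dot_epsl. Qed.

Lemma ffun_neq_ex a b : a != b -> exists j, a j != b j.
Proof.
move=> ab; apply/existsP; apply: contraNT ab; rewrite negb_exists => /forallP E.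
by apply/eqP/ffunP => j; apply/eqP/negPn/E.
Qed.

(** [QZ] walks along one coordinate; the induction on [s] then fills in the coordinates of [a] one
    after another. *)
Lemma ffun_eps_ind (Q : {ffun 'I_n -> int} -> Prop) : Q 0 ->
  (forall i a, Q a -> Q (eps i + a)) -> (forall i a, Q a -> Q (- eps i + a)) ->
  forall a, Q a.
Proof.
move=> Q0 QD QB a.
have QZ i z b : Q b -> Q ([ffun j => if j == i then z else 0] + b).
  move=> Qb; case: z => m; elim: m => [|m IH].
  - by rewrite (_ : [ffun j => _] = 0) ?add0r //; apply/ffunP => j; rewrite !ffunE; case: ifP.
  - have := QD i _ IH; congr (Q _); apply/ffunP => j; rewrite !ffunE addrA.
    by congr (_ + _); case: eqP => _; lia.
  - have := QB i _ Qb; congr (Q _); apply/ffunP => j; rewrite !ffunE.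
    by congr (_ + _); case: eqP => _; lia.
  - have := QB i _ IH; congr (Q _); apply/ffunP => j; rewrite !ffunE addrA.
    by congr (_ + _); case: eqP => _; lia.
suff QS (s : seq 'I_n) : uniq s -> Q [ffun j => if j \in s then a j else 0].
  have := QS (enum 'I_n) (enum_uniq _); congr (Q _); apply/ffunP => j.
  by rewrite ffunE mem_enum.
elim: s => [_|i s IH /= /andP[is_ us]].
  by rewrite (_ : [ffun j => _] = 0) //; apply/ffunP => j; rewrite !ffunE.
have := QZ i (a i) _ (IH us); congr (Q _); apply/ffunP => j; rewrite !ffunE inE.
by case: eqP => [->|_]; rewrite ?(negPf is_) ?addr0 ?add0r.
Qed.

End Pairing.

Section ShiftOperators.
Variables (K : fieldType) (X : zmodType).
Implicit Types (h : X -> K) (e : X).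

Lemma shiftop_subproof h e : fun_linear (fun (g : X -> K) k => h k * g (k + e)).
Proof. by move=> c g g'; apply/funext => k; rewrite mulrDr mulrCA. Qed.

(** Weighted shifts are closed under products, so relations between them split into an identity of
    weights and one of translations. *)
Definition shiftop h e : fun_end K X := FunEnd (shiftop_subproof h e).

Lemma shiftop_ext h h' e e' : h =1 h' -> e = e' -> shiftop h e = shiftop h' e'.
Proof. by move=> /funext-> ->. Qed.

Lemma shiftop1 : shiftop (fun=> 1) 0 = 1.
Proof. by apply: fun_endP => g k /=; rewrite mul1r addr0. Qed.

Lemma shiftopM h h' e e' :
  shiftop h e * shiftop h' e' = shiftop (fun k => h k * h' (k + e)) (e + e').
Proof. by apply: fun_endP => g k /=; rewrite mulrA addrA. Qed.

Lemma shiftopB h h' e : shiftop h e - shiftop h' e = shiftop (fun k => h k - h' k) e.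
Proof. by apply: fun_endP => g k /=; rewrite mulrBl. Qed.

Lemma shiftopZ c h e : c *: shiftop h e = shiftop (fun k => c * h k) e.
Proof. by apply: fun_endP => g k /=; rewrite mulrA. Qed.

Lemma shiftopX h m : shiftop h 0 ^+ m = shiftop (fun k => h k ^+ m) 0.
Proof.
elim: m => [|m IH]; first by rewrite expr0 -shiftop1; apply: shiftop_ext.
rewrite exprS IH shiftopM addr0; apply: shiftop_ext => // k.
by rewrite addr0 exprS.
Qed.

Lemma shiftop_comm h h' e e' : (forall k, h (k + e') = h k) ->
  (forall k, h' (k + e) = h' k) -> shiftop h e * shiftop h' e' = shiftop h' e' * shiftop h e.
Proof.
move=> hE h'E; rewrite !shiftopM; apply: shiftop_ext => [k|]; last exact: addrC.
by rewrite hE h'E mulrC.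
Qed.

End ShiftOperators.

Section QuantumTorus.
Variables (K : fieldType) (q : K) (n : nat).
Hypotheses (hq0 : q != 0) (hq : not_root_of_unity q).
Notation G := {ffun 'I_n -> int}.

Lemma q_expz_eq1 (z : int) : q ^ z = 1 -> z = 0.
Proof.
case: z => [[//|m]|m].
  by move=> /eqP; rewrite -exprnP (negPf (hq _)).
move/(congr1 (fun x => x^-1)); rewrite NegzE -exprnN invrK invr1 => /eqP.
by rewrite (negPf (hq _)).
Qed.

Lemma q_expz_inj : injective (exprz q).
Proof.
move=> z z' E; apply/eqP; rewrite -subr_eq0; apply/eqP/q_expz_eq1.
by rewrite expfzDr // E -expfzDr // subrr.
Qed.

(** The monomial x^(p.1) y^(p.2) of the quantum torus, where x_i multiplies by q^(k_i) and y_i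
    translates by e_i. *)
Definition torus (p : G * G) : fun_end K G :=
  shiftop (fun k : G => q ^ dot p.1 k) p.2.

Lemma torus0 : torus 0 = 1.
Proof. by rewrite -shiftop1; apply: shiftop_ext => // k; rewrite dot0l. Qed.

Lemma torusM p r : torus p * torus r = q ^ dot r.1 p.2 *: torus (p + r).
Proof.
rewrite shiftopM shiftopZ; apply: shiftop_ext => // k.
rewrite -[(p + r).1]/(p.1 + r.1) dotDl dotDr !expfzDr //; ring.
Qed.

Lemma torus_mul_scalar p r : exists2 c : K, c != 0 & torus p * torus r = c *: torus (p + r).
Proof. by exists (q ^ dot r.1 p.2); rewrite ?expfz_neq0 // torusM. Qed.

Lemma torus_rreg p (x : fun_end K G) : x * torus p = 0 -> x = 0.
Proof.
move=> /(congr1 ( *%R^~ (torus (- p)))); rewrite /= mul0r -mulrA torusM subrr torus0.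
rewrite -scalerAr mulr1 => /eqP; rewrite scaler_eq0 => /orP[|/eqP//].
by rewrite (negPf (expfz_neq0 _ hq0)).
Qed.

(** Commuting [torus r] past [torus p] costs the factor [chi r p]. Pure translations detect [p.1]
    and pure multiplications detect [p.2], because the integer powers of [q] are distinct. *)
Lemma torus_indep (s : seq (G * G)) (a : G * G -> fun_end K G) : uniq s ->
  (forall d, in_line torus d (a d)) -> \sum_(d <- s) a d = 0 ->
  forall d, d \in s -> a d = 0.
Proof.
move=> us aE.
pose chi (r p : G * G) : K := q ^ (dot p.1 r.2 - dot r.1 p.2).
apply: (@eigen_indep K _ _ _ _ (fun r => @lmul K _ (torus r))
  (fun r => @rmul K _ (torus r)) chi) => // [r p|r v|p p' pp'] /=.
- rewrite /lmul /rmul; have [c ->] := aE p.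
  rewrite -scalerAr -scalerAl !torusM !scalerA addrC; congr (_ *: _).
  by rewrite mulrC mulrAC -expfzDr // subrK mulrC.
- exact: torus_rreg.
have [a1|/ffun_neq_ex[j aj]] := eqVneq p.1 p'.1; last first.
  exists (0, eps j); apply: contra aj => /eqP/q_expz_inj; rewrite /= !dot0l !subr0.
  by rewrite !dot_epsr => ->.
have /ffun_neq_ex[j aj] : p.2 != p'.2.
  apply: contra pp'; case: p p' a1 => [a1 a2] [b1 b2] /= -> /eqP ->; exact: eqxx.
exists (eps j, 0); apply: contra aj => /eqP/q_expz_inj; rewrite /= !dot0r !sub0r.
by rewrite !dot_epsl => /oppr_inj ->.
Qed.

End QuantumTorus.

(** * The action of the generators on functions on Z^n *)

Section Representation.
Variables (K : fieldType) (q : K) (t n : nat).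
Hypotheses (hq0 : q != 0) (hq : not_root_of_unity q).
Notation G := {ffun 'I_n -> int}.

Definition rep_O (i : 'I_n) : fun_end K G := shiftop (fun k : G => q ^ k i) 0.
Definition rep_Oi (i : 'I_n) : fun_end K G := shiftop (fun k : G => q ^ (- k i)) 0.
Definition rep_P (i : 'I_n) : fun_end K G := shiftop (fun=> 1) (eps i).
(** The weight is dictated by the relation for [Pd i * P i]. It vanishes where [k i = 0], which is
    the source of all the later vanishing arguments. *)
Definition rep_Pd (i : 'I_n) : fun_end K G :=
  shiftop (fun k : G => (q ^+ t - q ^- t)^-1 * ((q ^ k i) ^+ t - (q ^ (- k i)) ^+ t))
          (- eps i).

Definition supported_at (i : 'I_n) (x : fun_end K G) := exists (h : G -> K) (e : G),
  [/\ x = shiftop h e, forall k k' : G, k i = k' i -> h k = h k'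
    & forall j, j != i -> e j = 0].

Lemma supported_comm i j x y : i != j -> supported_at i x -> supported_at j y ->
  x * y = y * x.
Proof.
move=> ij [h [e [-> hE eE]]] [h' [e' [-> h'E e'E]]].
apply: shiftop_comm => k; [apply: hE|apply: h'E]; rewrite ffunE.
  by rewrite e'E ?addr0.
by rewrite eE ?addr0 // eq_sym.
Qed.

Lemma rep_rels : Hn_rels q t rep_O rep_Oi rep_P rep_Pd.
Proof.
have eii (i : 'I_n) : eps i i = 1 by rewrite ffunE eqxx.
have eN (i : 'I_n) : (- eps i) i = -1 by rewrite ffunE eii.
split=> [i|i j ij x y xi yj].
  split; first split.
  - rewrite shiftopM -shiftop1; apply: shiftop_ext => [k|]; last exact: addr0.
    by rewrite addr0 -expfzDr // subrr.
  - rewrite shiftopM -shiftop1; apply: shiftop_ext => [k|]; last exact: addr0.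
    by rewrite addr0 -expfzDr // addNr.
  - rewrite !shiftopM shiftopZ; apply: shiftop_ext => [k|]; last exact: addrC.
    by rewrite mul1r mulr1 ffunE eii expfzDr // mulrC.
  - rewrite !shiftopM shiftopZ; apply: shiftop_ext => [k|]; last exact: addrC.
    by rewrite addr0 ffunE eN expfzDr // exprN1; ring.
  - rewrite !shiftopM !shiftopX !shiftopZ shiftopB shiftopZ.
    apply: shiftop_ext => [k|]; last exact: subrr.
    rewrite mul1r ffunE eii opprD !expfzDr // exprN1 expr1z !exprMn exprVn; ring.
  - rewrite !shiftopM !shiftopX shiftopB shiftopZ; apply: shiftop_ext => [k|].
      by rewrite mulr1.
    by rewrite addrC subrr.
have sup k z : z \in gens rep_O rep_Oi rep_P rep_Pd k -> supported_at k z.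
  rewrite !inE => /or4P[]/eqP->.
  - exists (fun k' : G => q ^ k' k), 0; split=> // [k1 k2 ->//|j' _]; exact: ffunE.
  - exists (fun k' : G => q ^ (- k' k)), 0; split=> // [k1 k2 ->//|j' _]; exact: ffunE.
  - by exists (fun=> 1), (eps k); split=> // j' jk; rewrite ffunE (negPf jk).
  - eexists; eexists; split; first reflexivity; first by move=> k1 k2 /= ->.
    by move=> j' jk; rewrite !ffunE (negPf jk) oppr0.
exact: supported_comm ij (sup _ _ xi) (sup _ _ yj).
Qed.

End Representation.

(** * The structure of the tensor power and its endomorphisms *)

(** The element [x] passes the factors in front of the [i]-th one, is exchanged there for [l], and
    [l] commutes back to the front. This drives all computations with [mono] and [ladder]. *)
Lemma prod_update (R : pzRingType) (I : eqType) (r : seq I) (i : I) (x l : R)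
    (F F' : I -> R) :
  uniq r -> i \in r -> x * F i = l * F' i ->
  (forall j, j != i -> [/\ x * F j = F j * x, l * F j = F j * l & F' j = F j]) ->
  x * \prod_(j <- r) F j = l * \prod_(j <- r) F' j.
Proof.
move=> + + xF comm; elim: r => [//|k r IH] /= /andP[kr ur].
rewrite inE !big_cons !mulrA => /orP[/eqP ik|ir].
  subst k; rewrite xF; congr (_ * _); apply: eq_big_seq => j jr.
  by have [|_ _ ->] := comm j; first by apply: contraNneq kr => <-.
have [|xk lk ->] := comm k; first by apply: contraNneq kr => ->.
by rewrite xk lk -!mulrA IH.
Qed.

Lemma skew_comm_inv (K : fieldType) (B : algType K) (c : K) (x u ui : B) :
  c != 0 -> u * ui = 1 -> ui * u = 1 -> x * u = c *: (u * x) ->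
  x * ui = c^-1 *: (ui * x).
Proof.
move=> c0 uui uiu xu; have ux : u * x = c^-1 *: (x * u).
  by rewrite xu scalerA mulVf // scale1r.
rewrite -[x in LHS]mul1r -uiu -[ui * u * x]mulrA ux -scalerAr -scalerAl.
by rewrite -!mulrA uui mulr1.
Qed.

Section IntegerPower.
Variables (R : pzRingType) (x xi : R).

(** [xi] need not invert [x]: the same formula serves for [O i], [Oi i] and for [P i], [Pd i]. *)
Definition zpow (z : int) : R :=
  match z with Posz m => x ^+ m | Negz m => xi ^+ m.+1 end.

Lemma comm_zpow y z : y * x = x * y -> y * xi = xi * y -> y * zpow z = zpow z * y.
Proof. by move=> yx yxi; case: z => m; apply: commrX. Qed.

Lemma zpowS z : x * xi = 1 -> x * zpow z = zpow (1 + z).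
Proof.
move=> xxi; case: z => [m|[|m]]; first by rewrite /= -exprS.
  by rewrite /= expr1.
by rewrite (_ : 1 + Negz m.+1 = Negz m) /= ?exprS ?mulrA ?xxi ?mul1r //; lia.
Qed.

End IntegerPower.

(** The family [U] is arbitrary because the lemma is applied to [mono] and to its images under [phi]
    and under an endomorphism. *)
Lemma homogeneous_indep (K : fieldType) (q : K) (n : nat) (B : algType K)
    (U : {ffun 'I_n -> int} -> B) (s : seq {ffun 'I_n -> int})
    (y : {ffun 'I_n -> int} -> B) :
  q != 0 -> not_root_of_unity q -> (forall a x, x * U a = 0 -> x = 0) -> uniq s ->
  (forall a d, U a * y d = q ^ (- dot a d) *: (y d * U a)) ->
  \sum_(d <- s) y d = 0 -> forall d, d \in s -> y d = 0.
Proof.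
move=> hq0 hq Ureg us yE.
apply: (@eigen_indep K _ _ _ _ (fun a => @lmul K _ (U a)) (fun a => @rmul K _ (U a))
  (fun a d => q ^ (- dot a d))) => // d e /ffun_neq_ex[j dj].
exists (eps j); rewrite !dot_epsl; apply: contra dj => /eqP.
by move/(q_expz_inj hq0 hq)/oppr_inj/eqP.
Qed.

(** * The grading of the algebra by Z^n *)

Section Structure.
Variables (K : fieldType) (q : K) (t n : nat) (A : algType K).
Variables (O Oi P Pd : 'I_n -> A).
Hypotheses (hq0 : q != 0) (hq : not_root_of_unity q) (ht : (0 < t)%N).
Hypothesis hA : is_Hn_tensor q t O Oi P Pd.
Notation G := {ffun 'I_n -> int}.

Let relA i : H_rels q t (O i) (Oi i) (P i) (Pd i).
Proof. by case: hA => -[]. Qed.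

Let commA i j x y : i != j -> x \in gens O Oi P Pd i -> y \in gens O Oi P Pd j ->
  x * y = y * x.
Proof. by move=> ij; case: hA => -[_ /(_ i j ij)] + _; apply. Qed.

Let OOi i : O i * Oi i = 1. Proof. by case: (relA i) => -[]. Qed.
Let OiO i : Oi i * O i = 1. Proof. by case: (relA i) => -[]. Qed.
Let gO i : O i \in gens O Oi P Pd i. Proof. by rewrite !inE eqxx. Qed.
Let gOi i : Oi i \in gens O Oi P Pd i. Proof. by rewrite !inE eqxx ?orbT. Qed.
Let gP i : P i \in gens O Oi P Pd i. Proof. by rewrite !inE eqxx ?orbT. Qed.
Let gPd i : Pd i \in gens O Oi P Pd i. Proof. by rewrite !inE eqxx ?orbT. Qed.

Definition mono (a : G) : A := \prod_(i < n) zpow (O i) (Oi i) (a i).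
Definition ladder (d : G) : A := \prod_(i < n) zpow (P i) (Pd i) (d i).

Lemma mono0 : mono 0 = 1.
Proof. by rewrite /mono big1 // => i _; rewrite ffunE. Qed.

Lemma ladder0 : ladder 0 = 1.
Proof. by rewrite /ladder big1 // => i _; rewrite ffunE. Qed.

Lemma mono_epsD i a : mono (eps i + a) = O i * mono a.
Proof.
symmetry; rewrite -[RHS]mul1r.
apply: (prod_update (index_enum_uniq _) (mem_index_enum i)) => [|j ji].
  by rewrite mul1r zpowS // !ffunE eqxx.
rewrite mul1r mulr1 !ffunE (negPf ji) add0r; split=> //.
by apply: comm_zpow; apply: (@commA i j); rewrite // eq_sym.
Qed.

Lemma mono_epsB i a : mono (- eps i + a) = Oi i * mono a.
Proof.
rewrite -[a in RHS](subrK (eps i)) [_ - eps i + _]addrC mono_epsD.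
by rewrite mulrA OiO mul1r addrC.
Qed.

Lemma monoD a b : mono (a + b) = mono a * mono b.
Proof.
elim/ffun_eps_ind: a => [|i a IH|i a IH]; first by rewrite add0r mono0 mul1r.
  by rewrite -addrA !mono_epsD IH mulrA.
by rewrite -addrA !mono_epsB IH mulrA.
Qed.

Lemma monoVr a : mono a * mono (- a) = 1. Proof. by rewrite -monoD subrr mono0. Qed.
Lemma monoVl a : mono (- a) * mono a = 1. Proof. by rewrite -monoD addNr mono0. Qed.

Lemma mono_eps i : mono (eps i) = O i.
Proof. by rewrite -[eps i]addr0 mono_epsD mono0 mulr1. Qed.

Lemma mono_Neps i : mono (- eps i) = Oi i.
Proof. by rewrite -[- eps i]addr0 mono_epsB mono0 mulr1. Qed.

Lemma mono_rreg a x : x * mono a = 0 -> x = 0.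
Proof. by move=> xa; rewrite -[x]mulr1 -(monoVr a) mulrA xa mul0r. Qed.

Lemma mono_skew x (c : G) : (forall i, x * O i = q ^ c i *: (O i * x)) ->
  forall a, x * mono a = q ^ dot a c *: (mono a * x).
Proof.
move=> xO a; elim/ffun_eps_ind: a => [|i a IH|i a IH].
- by rewrite mono0 mulr1 mul1r dot0l scale1r.
- rewrite mono_epsD mulrA xO -scalerAl -[O i * x * _]mulrA IH -scalerAr scalerA mulrA.
  by rewrite -expfzDr // dotDl dot_epsl.
- have xOi := skew_comm_inv (expfz_neq0 _ hq0) (OOi i) (OiO i) (xO i).
  rewrite mono_epsB mulrA xOi -scalerAl -[Oi i * x * _]mulrA IH -scalerAr scalerA mulrA.
  by rewrite invr_expz -expfzDr // dotDl dotNl dot_epsl.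
Qed.

(** The grading by conjugation weights; the sign gives [P i] the degree [eps i]. *)
Definition homogeneous (d : G) (x : A) :=
  forall a, mono a * x = q ^ (- dot a d) *: (x * mono a).

Lemma homogeneousP (d : G) x : (forall i, x * O i = q ^ d i *: (O i * x)) -> homogeneous d x.
Proof.
by move=> xO a; rewrite (mono_skew xO) scalerA -expfzDr // addNr scale1r.
Qed.

Lemma homogeneousM d e x y :
  homogeneous d x -> homogeneous e y -> homogeneous (d + e) (x * y).
Proof.
move=> hx hy a; rewrite mulrA hx -scalerAl -[x * mono a * y]mulrA hy -scalerAr scalerA mulrA.
by rewrite -expfzDr // dotDr opprD.
Qed.

Lemma homogeneous1 : homogeneous 0 1.
Proof. by move=> a; rewrite dot0r scale1r mulr1 mul1r. Qed.

Lemma homogeneous_mono a : homogeneous 0 (mono a).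
Proof. by move=> b; rewrite dot0r scale1r -!monoD addrC. Qed.

Lemma homogeneous_P i : homogeneous (eps i) (P i).
Proof.
apply: homogeneousP => j; rewrite ffunE; case: (eqVneq j i) => [->|ji].
  by case: (relA i) => _ ->.
by rewrite scale1r; apply: commA (gP i) (gO j); rewrite eq_sym.
Qed.

Lemma homogeneous_Pd i : homogeneous (- eps i) (Pd i).
Proof.
apply: homogeneousP => j; rewrite !ffunE; case: (eqVneq j i) => [->|ji].
  by case: (relA i) => _ _ -> *; rewrite exprN1.
by rewrite oppr0 scale1r; apply: commA (gPd i) (gO j); rewrite eq_sym.
Qed.

Lemma homogeneousX d x m : homogeneous d x -> homogeneous (d *+ m) (x ^+ m).
Proof.
move=> hx; elim: m => [|m IH]; first exact: homogeneous1.
by rewrite exprS mulrS; apply: homogeneousM.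
Qed.

Lemma homogeneous_ladder d : homogeneous d (ladder d).
Proof.
have dE : d = \sum_i eps i *~ d i.
  apply/ffunP => j; rewrite sum_ffunE (bigD1 j) //= big1 => [|i ij].
    by rewrite ffunMzE ffunE eqxx addr0 mulrzz mul1r.
  by rewrite ffunMzE ffunE eq_sym (negPf ij) mul0rz.
rewrite {1}dE; apply: (big_ind2 homogeneous) => [|d1 x d2 y|i _].
- exact: homogeneous1.
- exact: homogeneousM.
case: (d i) => m /=; first by apply: homogeneousX; apply: homogeneous_P.
rewrite NegzE mulrNz -mulNrz; apply: homogeneousX; exact: homogeneous_Pd.
Qed.

(** Laurent polynomials in the commuting units [O i]; they turn out to be exactly the elements of
    degree 0. *)
Definition laurent : A -> Prop := fsum (in_line mono) (fun=> True).

Lemma laurent_mono c a : laurent (c *: mono a).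
Proof. by apply: (fsum1 (in_line0 mono) (in_lineE mono a c)). Qed.

Lemma laurent0 : laurent 0. Proof. exact (fsum0 (in_line0 mono) _). Qed.

Lemma laurentB x y : laurent x -> laurent y -> laurent (x - y).
Proof. exact: (fsumB (in_lineB (E := mono))). Qed.

Lemma laurentD x y : laurent x -> laurent y -> laurent (x + y).
Proof. exact: (fsumD (in_line0 mono) (in_lineB (E := mono))). Qed.

Lemma mono_mul_scalar a b : exists2 c : K, c != 0 & mono a * mono b = c *: mono (a + b).
Proof. by exists 1; rewrite ?oner_eq0 // scale1r monoD. Qed.

Lemma laurentM x y : laurent x -> laurent y -> laurent (x * y).
Proof.
apply: (fsumM (in_line0 mono) (in_lineB (E := mono))) => //.
exact: in_lineM mono_mul_scalar.
Qed.

Lemma laurent_id a : laurent (mono a).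
Proof. by rewrite -[mono a]scale1r; apply: laurent_mono. Qed.

Lemma laurent1 : laurent 1. Proof. by rewrite -mono0; apply: laurent_id. Qed.

Lemma laurentZ c x : laurent x -> laurent (c *: x).
Proof.
move=> Lx; rewrite -[x]mul1r scalerAl; apply: laurentM => //.
by rewrite -mono0; apply: laurent_mono.
Qed.

Lemma laurentX x m : laurent x -> laurent (x ^+ m).
Proof.
move=> Lx; elim: m => [|m IH]; first exact: laurent1.
by rewrite exprS; apply: laurentM.
Qed.

Lemma laurent_O i : laurent (O i). Proof. by rewrite -mono_eps; apply: laurent_id. Qed.
Lemma laurent_Oi i : laurent (Oi i). Proof. by rewrite -mono_Neps; apply: laurent_id. Qed.

Lemma laurent_PPd i : laurent (P i * Pd i).
Proof.
case: (relA i) => _ _ _ -> _.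
by apply/laurentZ/laurentB; apply/laurentZ/laurentX; [apply: laurent_O|apply: laurent_Oi].
Qed.

Lemma laurent_PdP i : laurent (Pd i * P i).
Proof.
case: (relA i) => _ _ _ _ ->.
by apply/laurentZ/laurentB; apply/laurentX; [apply: laurent_O|apply: laurent_Oi].
Qed.

Lemma homogeneous_laurent x : laurent x -> homogeneous 0 x.
Proof.
move=> Lx; elim/fsum_ind: x / Lx => [a|x y hx hy a|b x [c ->] _ a].
- by rewrite mulr0 mul0r scaler0.
- by rewrite mulrDr hx hy -scalerDr -mulrDl.
- by rewrite -scalerAr homogeneous_mono -scalerAl !scalerA mulrC.
Qed.

Lemma laurent_skew x d l : homogeneous d x -> laurent l ->
  exists2 l', laurent l' & x * l = l' * x.
Proof.
move=> hx Ll; elim/fsum_ind: l / Ll => [|l m [l1 L1 E1] [m1 M1 F1]|b l [c ->] _].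
- by exists 0; rewrite ?mulr0 ?mul0r //; apply: laurent0.
- by exists (l1 + m1); rewrite ?mulrDr ?mulrDl ?E1 ?F1 //; apply: laurentD.
exists ((c * q ^ dot b d) *: mono b); first exact: laurent_mono.
by rewrite -scalerAr -scalerAl hx scalerA -mulrA -expfzDr // subrr mulr1.
Qed.

Definition component (d : G) (x : A) := exists2 l, laurent l & x = l * ladder d.

Lemma component0 d : component d 0.
Proof. by exists 0; [apply: laurent0|rewrite mul0r]. Qed.

Lemma componentB d x y : component d x -> component d y -> component d (x - y).
Proof.
move=> [l Ll ->] [m Lm ->]; exists (l - m); first exact: laurentB.
by rewrite mulrBl.
Qed.

Lemma component_homogeneous d x : component d x -> homogeneous d x.
Proof.
move=> [l /homogeneous_laurent hl ->]; rewrite -[d]add0r.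
by apply: homogeneousM => //; rewrite add0r; apply: homogeneous_ladder.
Qed.

(** A generator of index [i] only touches the [i]-th factor of a ladder, so a computation in that
    factor suffices. *)
Lemma ladder_step i (d : G) (x l : A) (e : int) :
  x \in gens O Oi P Pd i ->
  (forall j z, j != i -> z \in gens O Oi P Pd j -> l * z = z * l) ->
  x * zpow (P i) (Pd i) (d i) = l * zpow (P i) (Pd i) (e + d i) ->
  x * ladder d = l * ladder ([ffun j => if j == i then e else 0] + d).
Proof.
move=> xi lz xE.
apply: (prod_update (index_enum_uniq _) (mem_index_enum i)) => [|j ji].
  by rewrite !ffunE eqxx.
have ij : i != j by rewrite eq_sym.
rewrite !ffunE (negPf ji) add0r; split=> //; apply: comm_zpow.
- exact: commA xi (gP j).
- exact: commA xi (gPd j).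
- exact: lz (gP j).
- exact: lz (gPd j).
Qed.

Lemma commA_mul i j x y z : i != j -> x \in gens O Oi P Pd i ->
  y \in gens O Oi P Pd i -> z \in gens O Oi P Pd j -> x * y * z = z * (x * y).
Proof.
by move=> ij xi yi zj; rewrite -mulrA (commA ij yi zj) mulrA (commA ij xi zj) mulrA.
Qed.

(** If [d i] is nonnegative the power of [P i] just grows; otherwise [P i] meets a [Pd i], and
    [P i * Pd i] is a Laurent polynomial. *)
Lemma P_ladder i d : exists2 l, laurent l & P i * ladder d = l * ladder (eps i + d).
Proof.
have eE : [ffun j => if j == i then 1 else 0] = eps i.
  by apply/ffunP => j; rewrite !ffunE; case: eqP.
case E : (d i) => [m|m].
  exists 1; first exact: laurent1.
  rewrite -eE; apply: ladder_step (gP i) _ _ => [j z _ _|]; first by rewrite mulr1 mul1r.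
  by rewrite E mul1r /= -exprS.
exists (P i * Pd i); first exact: laurent_PPd.
rewrite -eE; apply: ladder_step (gP i) _ _ => [j z ji zj|].
  by apply: (@commA_mul i j); rewrite // eq_sym.
rewrite E; case: m {E} => [|m]; first by rewrite /= mulr1 expr1.
by rewrite (_ : 1 + Negz m.+1 = Negz m) /= ?exprS ?mulrA //; lia.
Qed.

(** Without a Laurent factor, the equation can be read backwards to split a [Pd i] off the front of
    a ladder. *)
Lemma Pd_ladder_le0 i (d : G) : d i <= 0 -> Pd i * ladder d = ladder (- eps i + d).
Proof.
have eE : [ffun j => if j == i then -1 else 0] = - eps i.
  by apply/ffunP => j; rewrite !ffunE; case: eqP.
move=> di; rewrite -[RHS]mul1r -eE; apply: ladder_step (gPd i) _ _ => [j z _ _|].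
  by rewrite mulr1 mul1r.
rewrite mul1r; case: (d i) di => [[|m]|m] // _; first by rewrite /= mulr1 expr1.
Qed.

Lemma Pd_ladder i d : exists2 l, laurent l & Pd i * ladder d = l * ladder (- eps i + d).
Proof.
have [di|di] := leP (d i) 0.
  by exists 1; [apply: laurent1|rewrite mul1r Pd_ladder_le0].
have eE : [ffun j => if j == i then -1 else 0] = - eps i.
  by apply/ffunP => j; rewrite !ffunE; case: eqP.
exists (Pd i * P i); first exact: laurent_PdP.
rewrite -eE; apply: ladder_step (gPd i) _ _ => [j z ji zj|].
  by apply: (@commA_mul i j); rewrite // eq_sym.
case: (d i) di => [[|m]|m] // _.
by rewrite (_ : - 1 + Posz m.+1 = Posz m) /= ?exprS ?mulrA //; lia.
Qed.

Lemma ladder_eps i : ladder (eps i) = P i.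
Proof.
have eE : [ffun j => if j == i then 1 else 0] = eps i.
  by apply/ffunP => j; rewrite !ffunE; case: eqP.
suff E : P i * ladder 0 = 1 * ladder (eps i + 0).
  by rewrite addr0 mul1r ladder0 mulr1 in E.
rewrite -eE; apply: ladder_step (gP i) _ _ => [j z _ _|].
  by rewrite mulr1 mul1r.
by rewrite ffunE /= mulr1 mul1r.
Qed.

Lemma ladder_Neps i : ladder (- eps i) = Pd i.
Proof. by rewrite -[- eps i]addr0 -Pd_ladder_le0 ?ffunE // ladder0 mulr1. Qed.

(** The sums of components contain 1 and are stable under left multiplication by each generator,
    hence by every [x]. *)
Lemma component_sum x : fsum component (fun=> True) x.
Proof.
pose S := fsum component (fun=> True).
have SD : forall x y, S x -> S y -> S (x + y).
  by move=> y z; apply: (fsumD component0 componentB).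
have S1 d l y : laurent l -> y = l * ladder d -> S y.
  by move=> Ll ->; apply: (fsum1 component0 (d := d)) => //; exists l.
have SL l y : laurent l -> S y -> S (l * y).
  move=> Ll Sy; elim/fsum_ind: y / Sy => [|y z Sy Sz|d y [m Lm ->] _].
  - by rewrite mulr0; exact (fsum0 component0 _).
  - by rewrite mulrDr; apply: SD.
  - by apply: (S1 d (l * m)); [apply: laurentM|rewrite mulrA].
have Sskew x' e y : homogeneous e x' ->
    (forall d, exists2 l, laurent l & x' * ladder d = l * ladder (e + d)) ->
    S y -> S (x' * y).
  move=> hx xd Sy; elim/fsum_ind: y / Sy => [|y z Sy Sz|d y [m Lm ->] _].
  - by rewrite mulr0; exact (fsum0 component0 _).
  - by rewrite mulrDr; apply: SD.
  have [m' Lm' mE] := laurent_skew hx Lm; have [l Ll lE] := xd d.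
  apply: (S1 (e + d) (m' * l)); first exact: laurentM.
  by rewrite mulrA mE -!mulrA lE.
suff SM y : S y -> S (x * y).
  rewrite -[x]mulr1; apply: SM; apply: (S1 0 1); first exact: laurent1.
  by rewrite ladder0 mulr1.
move: x y; apply: (Hn_tensor_ind hA).
- by move=> y; rewrite mul1r.
- move=> c x y Sx Sy z Sz; rewrite mulrDl; apply: SD; last exact: Sy.
  rewrite -scalerAl -[x * z]mul1r scalerAl; apply: SL; last exact: Sx.
  exact/laurentZ/laurent1.
- by move=> x y Sx Sy z Sz; rewrite -mulrA; apply/Sx/Sy.
move=> i; split=> y; first exact/SL/laurent_O.
- exact/SL/laurent_Oi.
- exact: Sskew (homogeneous_P i) (P_ladder i).
- exact: Sskew (homogeneous_Pd i) (Pd_ladder i).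
Qed.

Lemma component_indep (s : seq G) (y : G -> A) : uniq s ->
  (forall d, component d (y d)) -> \sum_(d <- s) y d = 0 ->
  forall d, d \in s -> y d = 0.
Proof.
move=> us yC; apply: (homogeneous_indep hq0 hq mono_rreg us) => a d.
exact: component_homogeneous (yC d) a.
Qed.

(** If a sum is an eigenvector for conjugation by [mono a], each nonzero component has its
    eigenvalue: apply independence to the differences of both sides. *)
Lemma component_weight (s : seq G) (y : G -> A) a (c : K) : uniq s ->
  (forall d, component d (y d)) ->
  mono a * (\sum_(d <- s) y d) = c *: ((\sum_(d <- s) y d) * mono a) ->
  forall d, d \in s -> y d != 0 -> q ^ (- dot a d) = c.
Proof.
move=> us yC E d ds yd0; apply/eqP; rewrite -subr_eq0.
suff /eqP : (q ^ (- dot a d) - c) *: y d = 0.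
  by rewrite scaler_eq0 (negPf yd0) orbF.
apply: (component_indep us (y := fun d => (q ^ (- dot a d) - c) *: y d)) => // [e|].
  have [l Ll ->] := yC e; exists ((q ^ (- dot a e) - c) *: l); first exact: laurentZ.
  by rewrite scalerAl.
apply: (@mono_rreg a); rewrite mulr_suml.
move: E; rewrite mulr_suml mulr_sumr => /eqP; rewrite -subr_eq0 => /eqP E.
rewrite -[RHS]E.
rewrite scaler_sumr -sumrB; apply: eq_bigr => e _.
by rewrite (component_homogeneous (yC e)) -scalerAl -scalerBl.
Qed.

(** Conjugation by the [mono (eps j)] reads off every coordinate of a degree, so components of
    degree other than [d] vanish. *)
Lemma homogeneous_component d x : homogeneous d x -> component d x.
Proof.
move=> hx; have [s [y [us yC _ xE]]] := component_sum x.
have y0 e : e \in s -> e != d -> y e = 0.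
  move=> es /ffun_neq_ex[j ej]; apply/eqP; apply: contraNT ej => ye.
  have E := hx (eps j); rewrite xE in E.
  have := component_weight us yC E es ye; rewrite !dot_epsl.
  by move/(q_expz_inj hq0 hq)/oppr_inj/eqP.
rewrite xE big_seq; apply: (big_ind (component d)) => [|u w Cu Cw|e es].
- exact: component0.
- rewrite -[w]opprK; apply: componentB => //; rewrite -sub0r.
  by apply: componentB => //; apply: component0.
by have [<-|/(y0 e es)->] := eqVneq e d; [apply: yC|apply: component0].
Qed.

(** * Faithfulness of the representation, zero divisors and units *)

Section Faithful.
Variable phi : {lrmorphism A -> fun_end K G}.
Hypothesis phiE : forall i, [/\ phi (O i) = rep_O q i, phi (Oi i) = rep_Oi q i,
  phi (P i) = rep_P K i & phi (Pd i) = rep_Pd q t i].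

Notation tor := (@torus K q n).

Lemma rep_O_torus i : rep_O q i = tor (eps i, 0).
Proof. by apply: shiftop_ext => // k; rewrite dot_epsl. Qed.

Lemma rep_Oi_torus i : rep_Oi q i = tor (- eps i, 0).
Proof. by apply: shiftop_ext => // k; rewrite dotNl dot_epsl. Qed.

Lemma rep_P_torus i : rep_P K i = tor (0, eps i).
Proof. by apply: shiftop_ext => // k; rewrite dot0l. Qed.

Lemma q_expzMn z m : q ^ (z *+ m) = (q ^ z) ^+ m.
Proof. by elim: m => [//|m IH]; rewrite mulrS expfzDr // IH exprS. Qed.

Lemma rep_Pd_torus i : rep_Pd q t i = (q ^+ t - q ^- t)^-1 *:
  (tor (eps i *+ t, - eps i) - tor (- eps i *+ t, - eps i)).
Proof.
have dotMn a k m : dot (a *+ m) k = dot a k *+ m :> int.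
  by elim: m => [|m IH]; rewrite ?dot0l // !mulrS dotDl IH.
rewrite shiftopB shiftopZ; apply: shiftop_ext => // k /=.
by rewrite !dotMn !q_expzMn dotNl dot_epsl.
Qed.

Lemma phi_mono a : phi (mono a) = tor (a, 0).
Proof.
elim/ffun_eps_ind: a => [|i a IH|i a IH].
- by rewrite mono0 rmorph1 torus0.
- rewrite mono_epsD rmorphM /= IH; case: (phiE i) => -> _ _ _.
  by rewrite rep_O_torus torusM // dot0r scale1r; congr (tor (_, _)); rewrite addr0.
- rewrite mono_epsB rmorphM /= IH; case: (phiE i) => _ -> _ _.
  by rewrite rep_Oi_torus torusM // dot0r scale1r; congr (tor (_, _)); rewrite addr0.
Qed.

Let span := fsum (in_line tor) (fun=> True).

Let spanD x y : span x -> span y -> span (x + y).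
Proof. exact: (fsumD (in_line0 tor) (in_lineB (E := tor))). Qed.

Let span_torus c p : span (c *: tor p).
Proof. exact (fsum1 (in_line0 tor) (in_lineE tor p c) I). Qed.

Let spanM x y : span x -> span y -> span (x * y).
Proof.
apply: (fsumM (in_line0 tor) (in_lineB (E := tor))) => //.
exact: in_lineM (torus_mul_scalar hq0).
Qed.

Lemma span_phi x : span (phi x).
Proof.
move: x; apply: (Hn_tensor_ind hA).
- by rewrite rmorph1 -(torus0 q n) -[tor 0]scale1r; apply: span_torus.
- move=> c x y Sx Sy; rewrite linearD linearZ /=; apply: spanD => //.
  rewrite -[phi x]mul1r scalerAl; apply: spanM => //.
  by rewrite -(torus0 q n); apply: span_torus.
- by move=> x y Sx Sy; rewrite rmorphM /=; apply: spanM.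
move=> i; case: (phiE i) => -> -> -> ->.
rewrite rep_O_torus rep_Oi_torus rep_P_torus rep_Pd_torus; split.
- by rewrite -[tor _]scale1r; apply: span_torus.
- by rewrite -[tor _]scale1r; apply: span_torus.
- by rewrite -[tor _]scale1r; apply: span_torus.
by rewrite scalerBr -scaleNr; apply: spanD; apply: span_torus.
Qed.

Lemma phi_domain x y : phi x * phi y = 0 -> phi x = 0 \/ phi y = 0.
Proof.
apply: (span_domain (torus0 q n) (torus_mul_scalar hq0) (torus_indep hq0 hq)
  (@lex_pos2_0 n) (@lex_pos2D n) (@lex_pos2_total n)); exact: span_phi.
Qed.

Lemma phi_P_neq0 i : phi (P i) != 0.
Proof.
case: (phiE i) => _ _ -> _; rewrite rep_P_torus.
exact: (E_neq0 (torus0 q n) (torus_mul_scalar hq0)).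
Qed.

Lemma qt_neq0 : q ^+ t - q ^- t != 0.
Proof.
rewrite subr_eq0; apply: contra (hq (m := t + t) _) => [/eqP E|].
  by rewrite exprD {2}E mulfV // expf_neq0.
by rewrite addn_gt0 ht.
Qed.

Lemma phi_Pd_neq0 i : phi (Pd i) != 0.
Proof.
case: (phiE i) => _ _ _ ->; apply/eqP.
move/(congr1 (fun F : fun_end K G => F (fun=> 1) (eps i)))/eqP.
by rewrite /= ffunE eqxx mulr1 expr1z exprN1 exprVn mulVf ?oner_eq0 ?qt_neq0.
Qed.

Lemma phi_ladder_neq0 d : phi (ladder d) != 0.
Proof.
apply: (big_ind (fun x => phi x != 0)) => [|x y x0 y0|i _].
- by rewrite rmorph1 oner_eq0.
- apply/eqP; rewrite rmorphM /= => /phi_domain[] /eqP.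
    by rewrite (negPf x0).
  by rewrite (negPf y0).
have X0 x m : phi x != 0 -> phi (x ^+ m) != 0.
  move=> x0; elim: m => [|m IH]; first by rewrite rmorph1 oner_eq0.
  apply/eqP; rewrite exprS rmorphM /= => /phi_domain[] /eqP.
    by rewrite (negPf x0).
  by rewrite (negPf IH).
by case: (d i) => m; apply: X0; [apply: phi_P_neq0|apply: phi_Pd_neq0].
Qed.

Lemma phi_laurent_inj l : laurent l -> phi l = 0 -> l = 0.
Proof.
move=> [s [a [us aM _ ->]]]; rewrite raddf_sum => sum0.
rewrite big_seq big1 // => d ds; have [c aE] := aM d.
(* The family is extended by zero to all pairs, so that [torus_indep] applies to the indices
   [(e, 0)]. *)
pose b (p : G * G) := if p.2 == 0 then phi (a p.1) else 0.
have : b (d, 0) = 0.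
  apply: (torus_indep hq0 hq (s := [seq (e, 0) | e <- s])).
  - by rewrite map_inj_uniq // => e e' [].
  - move=> [e e'] /=; rewrite /b /=; case: eqP => [->|_]; last exact: in_line0.
    by have [c' ->] := aM e; exists c'; rewrite linearZ /= phi_mono.
  - by rewrite big_map -[RHS]sum0; apply: eq_bigr => e _; rewrite /b /= eqxx.
  - by apply/mapP; exists d.
rewrite /b /= eqxx aE linearZ /= phi_mono => /eqP.
rewrite scaler_eq0 (negPf (E_neq0 (torus0 q n) (torus_mul_scalar hq0) _)) orbF.
by move/eqP->; rewrite scale0r.
Qed.

(** Conjugation by the [phi (mono b)] separates degrees, so every component lies in the kernel. It
    is a Laurent polynomial times a ladder, the ladder has nonzero image, and [phi] is injective on
    Laurent polynomials. *)
Lemma phi_eq0 x : phi x = 0 -> x = 0.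
Proof.
have [s [a [us aC _ ->]]] := component_sum x; rewrite raddf_sum => sum0.
rewrite big_seq big1 // => d ds.
have : phi (a d) = 0.
  apply: (homogeneous_indep (U := fun b => phi (mono b)) (y := phi \o a)
    hq0 hq _ us _ sum0) => // [b y|b e] /=.
    by rewrite phi_mono; apply: torus_rreg.
  have := congr1 phi (component_homogeneous (aC e) b).
  by rewrite linearZ /= !rmorphM.
have [l Ll ->] := aC d; rewrite rmorphM /= => /phi_domain[/phi_laurent_inj->|] //.
  by rewrite mul0r.
by move/eqP; rewrite (negPf (phi_ladder_neq0 d)).
Qed.

Lemma phi_inj : injective phi.
Proof.
move=> x y E; apply/eqP; rewrite -subr_eq0; apply/eqP/phi_eq0.
by rewrite rmorphB /= E subrr.
Qed.

Lemma Hn_domain (x y : A) : x * y = 0 -> x = 0 \/ y = 0.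
Proof.
move=> xy0; have /phi_domain[] : phi x * phi y = 0.
  by have := rmorphM phi x y; rewrite xy0 rmorph0 => <-.
- by left; apply: phi_eq0.
- by right; apply: phi_eq0.
Qed.

Lemma phi_laurent_local l (g : G -> K) k : laurent l -> g k = 0 -> phi l g k = 0.
Proof.
move=> Ll gk; elim/fsum_ind: l / Ll => [|x y Ex Ey|a x [c ->] _].
- by rewrite rmorph0.
- by rewrite rmorphD /= Ex Ey addr0.
- by rewrite linearZ /= phi_mono /= addr0 gk !mulr0.
Qed.

(* [Pd j] annihilates every function at the points with [k j = 0]. *)
Lemma component_vanishing (d : G) x j (g : G -> K) (k : G) :
  component d x -> d j < 0 -> k j = 0 -> phi x g k = 0.
Proof.
move=> [l Ll ->] dj kj; rewrite rmorphM /=; apply: phi_laurent_local => //.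
(* As [d j < 0], the exponent [d j + 1] is still at most 0, so one [Pd j] splits off in front; its
   weight is zero at [k]. *)
rewrite -[d](addKr (eps j)) -Pd_ladder_le0; last first.
  by rewrite !ffunE eqxx; move: dj; case: (d j) => // -[].
rewrite rmorphM /=; case: (phiE j) => _ _ _ ->.
by rewrite /= kj oppr0 !expr0z subrr mulr0 mul0r.
Qed.

(** In the torus a unit is a single monomial, so [x] is homogeneous of some degree [d] and [y] of
    degree [- d]. It remains to exclude [d != 0]. *)
Lemma unit_mono (x y : A) : x * y = 1 -> y * x = 1 ->
  exists a, exists2 c : K, c != 0 & x = c *: mono a.
Proof.
move=> xy yx.
have [[a d] [c c0 xE]] : exists p, exists2 c, c != 0 & phi x = c *: tor p.
  apply: (span_unit (torus0 q n) (torus_mul_scalar hq0) (torus_indep hq0 hq)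
    (@lex_pos2_0 n) (@lex_pos2D n) (@lex_pos2_total n) (y := phi y)).
  - exact: span_phi.
  - exact: span_phi.
  - by rewrite -rmorphM xy rmorph1.
have hx : homogeneous d x.
  move=> b; apply: phi_inj; rewrite linearZ /= !rmorphM /= phi_mono xE.
  rewrite -scalerAr -scalerAl !torusM //= dot0r scale1r !scalerA.
  rewrite mulrAC -expfzDr // addNr mul1r.
  by congr (_ *: tor _); rewrite addrC.
have hy : homogeneous (- d) y.
  move=> b; rewrite dotNr opprK.
  have := congr1 (fun z => y * z * y) (hx b).
  rewrite /= -scalerAr -scalerAl !mulrA yx mul1r -mulrA xy mulr1 => ->.
  by rewrite scalerA -expfzDr // subrr scale1r.
have cx := homogeneous_component hx; have cy := homogeneous_component hy.
(* An element with a negative coordinate in its degree yields functions vanishing at the origin,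
   whereas [u * w] fixes the constant function 1. *)
have no_neg e u w : component e u -> u * w = 1 -> forall j, e j < 0 -> False.
  move=> cu uw j ej; have := component_vanishing (phi w (fun=> 1)) (k := 0) cu ej.
  rewrite ffunE => /(_ erefl) /eqP.
  have -> : phi u (phi w (fun=> 1)) 0 = (phi u * phi w) (fun=> 1) 0 by [].
  by rewrite -rmorphM /= uw rmorph1 /= oner_eq0.
have d0 : d = 0.
  apply/ffunP => j; rewrite ffunE; apply/eqP; case: (ltgtP (d j) 0) => //.
    by move/(no_neg _ _ _ cx xy).
  by move=> dj; case: (no_neg _ _ _ cy yx j); rewrite ffunE oppr_lt0.
exists a, c => //; apply: phi_inj; rewrite linearZ /= phi_mono xE.
by rewrite d0.
Qed.

(** Move [b] to the left of [x] and cancel [x * y] in the domain: [a] has a right inverse, which is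
    two-sided in a domain. It will be applied to the Laurent coefficients of [f (P i)] and
    [f (Pd i)]. *)
Lemma laurent_factor_unit a b e x y (c : K) : laurent a -> laurent b ->
  homogeneous e x -> x * y != 0 -> c != 0 -> a * x * (b * y) = c *: (x * y) ->
  exists u, exists2 c' : K, c' != 0 & a = c' *: mono u.
Proof.
move=> La Lb hx xy0 c0 E; have [b' _ bE] := laurent_skew hx Lb.
have ab : a * b' = c%:A.
  apply/eqP; rewrite -subr_eq0; apply/eqP.
  have /Hn_domain[//|/eqP] : (a * b' - c%:A) * (x * y) = 0.
    rewrite mulrBl -scalerAl mul1r -E -!mulrA [b' * _]mulrA -bE -!mulrA subrr.
    by [].
  by rewrite (negPf xy0).
have acb : a * (c^-1 *: b') = 1 by rewrite -scalerAr ab scalerA mulVf // scale1r.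
apply: (unit_mono acb); apply/eqP; rewrite -subr_eq0; apply/eqP.
have /Hn_domain[a0|//] : a * (c^-1 *: b' * a - 1) = 0.
  by rewrite mulrBr mulrA acb mul1r mulr1 subrr.
by move/eqP: acb; rewrite a0 mul0r eq_sym oner_eq0.
Qed.

(** * Images of the generators and injectivity of an endomorphism *)

Section Endomorphism.
Variable f : {lrmorphism A -> A}.

Let fZ c x : f (c *: x) = c *: f x. Proof. exact: linearZ. Qed.
Let fB x y : f (x - y) = f x - f y. Proof. exact: rmorphB. Qed.
Let fX x m : f (x ^+ m) = f x ^+ m. Proof. exact: rmorphXn. Qed.
Let fM x y : f (x * y) = f x * f y. Proof. exact: rmorphM. Qed.
Let phiZ c x : phi (c *: x) = c *: phi x. Proof. exact: linearZ. Qed.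
Let phiB x y : phi (x - y) = phi x - phi y. Proof. exact: rmorphB. Qed.
Let phiM x y : phi (x * y) = phi x * phi y. Proof. exact: rmorphM. Qed.

Let uO i : f (O i) * f (Oi i) = 1. Proof. by rewrite -rmorphM OOi rmorph1. Qed.
Let uOi i : f (Oi i) * f (O i) = 1. Proof. by rewrite -rmorphM OiO rmorph1. Qed.

Lemma f_mono_neq0 a : f (mono a) != 0.
Proof.
apply/eqP => fa; have := rmorphM f (mono a) (mono (- a)).
by rewrite monoVr rmorph1 /= fa mul0r => /eqP; rewrite oner_eq0.
Qed.

Lemma f_mono_rreg a x : x * f (mono a) = 0 -> x = 0.
Proof.
by move=> /Hn_domain[//|/eqP]; rewrite (negPf (f_mono_neq0 a)).
Qed.

Lemma f_PPd i : f (P i) * f (Pd i) =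
  (q ^+ t - q ^- t)^-1 *: (q ^+ t *: f (O i) ^+ t - q ^- t *: f (Oi i) ^+ t).
Proof.
by rewrite -fM; case: (relA i) => _ _ _ -> _; rewrite fZ fB !fZ !fX.
Qed.

Lemma f_PdP i : f (Pd i) * f (P i) =
  (q ^+ t - q ^- t)^-1 *: (f (O i) ^+ t - f (Oi i) ^+ t).
Proof.
by rewrite -fM; case: (relA i) => _ _ _ _ ->; rewrite fZ fB !fX.
Qed.

(** Were one of them zero, both products would vanish. The two relations would then force
    [f (O i) ^+ t = 0], although [f (O i)] is invertible. *)
Lemma f_PPd_neq0 i : f (P i) != 0 /\ f (Pd i) != 0.
Proof.
suff H : ~ (f (P i) * f (Pd i) = 0 /\ f (Pd i) * f (P i) = 0).
  by split; apply/eqP => E; apply: H; rewrite E mulr0 mul0r.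
have c0 : (q ^+ t - q ^- t)^-1 != 0 by rewrite invr_eq0 qt_neq0.
move=> []; rewrite f_PPd f_PdP => /eqP; rewrite scaler_eq0 (negPf c0) /= => E /eqP.
rewrite scaler_eq0 (negPf c0) subr_eq0 /= => /eqP E'.
move: E; rewrite -E' -scalerBl scaler_eq0 (negPf qt_neq0) /= => /eqP E.
have : f (O i) ^+ t * f (Oi i) ^+ t = 1.
  rewrite -exprMn_comm ?uO ?expr1n // /GRing.comm.
  by rewrite uO uOi.
by rewrite E mul0r => /esym/eqP; rewrite oner_eq0.
Qed.

(** Distinct exponents are told apart by commuting [f (mono a)] past the elements [f (P j)], which
    are nonzero and hence cancellable. *)
Lemma f_laurent_inj l : laurent l -> f l = 0 -> l = 0.
Proof.
move=> [s [a [us aM _ ->]]]; rewrite raddf_sum => sum0.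
rewrite big_seq big1 // => d ds.
have : f (a d) = 0.
  apply: (@eigen_indep K _ _ _ _ (fun j => @lmul K _ (f (P j)))
    (fun j => @rmul K _ (f (P j))) (fun j (e : G) => q ^ e j) s (fun e => f (a e))) => //.
  - move=> j e; change (f (P j) * f (a e) = q ^ e j *: (f (a e) * f (P j))).
    have [c ->] := aM e; rewrite fZ -scalerAr -scalerAl -!fM (homogeneous_P j e) fZ dot_epsr fM.
    by rewrite !scalerA mulrAC -expfzDr // subrr mul1r.
  - move=> j v /Hn_domain[//|/eqP].
    by case: (f_PPd_neq0 j) => /negPf->.
  - move=> e e' /ffun_neq_ex[j ej]; exists j; apply: contra ej.
    by move/eqP/(q_expz_inj hq0 hq)->.
have [c ->] := aM d; rewrite fZ => /eqP.
by rewrite scaler_eq0 (negPf (f_mono_neq0 d)) orbF => /eqP->; rewrite scale0r.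
Qed.

(** The components of a kernel element lie in the kernel. Multiplied by [ladder (- d)], the one of
    degree [d] becomes a Laurent polynomial in the kernel, hence zero, and the ladder cancels. *)
Lemma f_inj : injective f.
Proof.
suff f0 x : f x = 0 -> x = 0.
  move=> x y E; apply/eqP; rewrite -subr_eq0; apply/eqP/f0.
  by rewrite fB E subrr.
have [s [a [us aC _ ->]]] := component_sum x; rewrite raddf_sum => sum0.
rewrite big_seq big1 // => d ds.
have fa : f (a d) = 0.
  apply: (homogeneous_indep (U := fun b => f (mono b)) (y := f \o a)
    hq0 hq f_mono_rreg us _ sum0) => // b e /=.
  have := congr1 f (component_homogeneous (aC e) b).
  by rewrite fZ !fM.
have c0 : component 0 (a d * ladder (- d)).
  apply: homogeneous_component; rewrite -(subrr d).
  by apply: homogeneousM; [apply: component_homogeneous|apply: homogeneous_ladder].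
have [l Ll lE] := c0; rewrite ladder0 mulr1 in lE.
have /Hn_domain[//|E] : a d * ladder (- d) = 0.
  by rewrite lE; apply: f_laurent_inj Ll _; rewrite -lE fM fa mul0r.
by have := phi_ladder_neq0 (- d); rewrite E rmorph0 eqxx.
Qed.

Lemma f_O_mono : exists (M : 'I_n -> G) (lam : 'I_n -> K),
  forall i, lam i != 0 /\ f (O i) = lam i *: mono (M i).
Proof.
have H i : exists p : G * K, p.2 != 0 /\ f (O i) = p.2 *: mono p.1.
  by have [a [c c0 E]] := unit_mono (uO i) (uOi i); exists (a, c).
have [p pE] := choice H.
by exists (fun i => (p i).1), (fun i => (p i).2).
Qed.

(** * Exponents of the images of the generators, and surjectivity *)

Section Exponents.
Variables (M : 'I_n -> G) (lam : 'I_n -> K).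
Hypotheses (lam0 : forall i, lam i != 0) (fO : forall i, f (O i) = lam i *: mono (M i)).

Lemma f_Oi i : f (Oi i) = (lam i)^-1 *: mono (- M i).
Proof.
have E : (lam i)^-1 *: mono (- M i) * f (O i) = 1.
  by rewrite fO -scalerAr -scalerAl monoVl scalerA divff ?scale1r.
by rewrite -[LHS]mul1r -E -mulrA uO mulr1.
Qed.

(** The scalar [lam j] cancels, so [mono (M j)] acts on [f x] as [O j] does on [x]. *)
Lemma mono_f_skew x d j : homogeneous d x ->
  mono (M j) * f x = q ^ (- d j) *: (f x * mono (M j)).
Proof.
move=> hx; have := congr1 f (hx (eps j)).
rewrite dot_epsl mono_eps fZ !fM fO -scalerAl -scalerAr => /eqP.
rewrite scalerA mulrC -scalerA -subr_eq0 -scalerBr scaler_eq0 (negPf (lam0 j)) /=.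
by rewrite subr_eq0 => /eqP.
Qed.

Lemma f_weight x d : homogeneous d x -> f x != 0 ->
  exists e, forall j, dot (M j) e = d j.
Proof.
move=> hx fx0; have [s [y [us yC _ fxE]]] := component_sum (f x).
have [e es ye] : exists2 e, e \in s & y e != 0.
  apply/hasP; apply: contraNT fx0 => /hasPn y0; rewrite fxE big_seq big1 // => e.
  by move/y0; rewrite negbK => /eqP.
exists e => j; have := mono_f_skew j hx; rewrite fxE => E.
have := component_weight us yC E es ye.
by move/(q_expz_inj hq0 hq)/oppr_inj.
Qed.

Lemma f_component x d e : homogeneous d x ->
  (forall e', (forall j, dot (M j) e' = d j) -> e' = e) -> component e (f x).
Proof.
move=> hx uniq_e; have [s [y [us yC _ fxE]]] := component_sum (f x).
rewrite fxE big_seq; apply: (big_ind (component e)) => [|u w Cu Cw|e' es].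
- exact: component0.
- rewrite -[w]opprK; apply: componentB => //; rewrite -sub0r.
  by apply: componentB => //; apply: component0.
have [->|ye] := eqVneq (y e') 0; first exact: component0.
rewrite -(uniq_e e') // => j; have := mono_f_skew j hx; rewrite fxE => E.
by have := component_weight us yC E es ye; move/(q_expz_inj hq0 hq)/oppr_inj.
Qed.

(** Any nonzero component of [f (P i)] has a degree dual to the [M j]. These degrees invert the
    exponent matrix, so a degree is determined by its pairings with the [M j], and only one
    component can occur. *)
Lemma dual_exponents : exists d : 'I_n -> G,
  [/\ forall i j, dot (M j) (d i) = eps i j,
      forall i, component (d i) (f (P i)) & forall i, component (- d i) (f (Pd i))].
Proof.
have H i : exists e : G, forall j, dot (M j) e = eps i j.
  by apply: f_weight (homogeneous_P i) _; case: (f_PPd_neq0 i).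
have [d dE] := choice H; exists d.
pose Mm : 'M[int]_n := \matrix_(i, j) M i j.
pose Dm : 'M[int]_n := \matrix_(j, i) d i j.
(* Duality says [Mm *m Dm = 1]; for square matrices a right inverse is a left inverse. *)
have DM : Dm *m Mm = 1%:M.
  apply: mulmx1C; apply/matrixP => i j; rewrite !mxE.
  transitivity (dot (M i) (d j)); first by apply: eq_bigr => k _; rewrite !mxE.
  by rewrite dE ffunE; case: eqP.
have Minj e e' : (forall j, dot (M j) e = dot (M j) e') -> e = e'.
  move=> E; pose col (u : G) : 'cV[int]_n := \col_i u i.
  have colE : Mm *m col e = Mm *m col e'.
    apply/matrixP => i j; rewrite !mxE.
    have dotE (u : G) : \sum_k Mm i k * col u k j = dot (M i) u.
      by apply: eq_bigr => k _; rewrite !mxE.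
    by rewrite !dotE E.
  have : col e = col e' by rewrite -[col e]mul1mx -[col e']mul1mx -DM -!mulmxA colE.
  by move=> /colP cE; apply/ffunP => i; have := cE i; rewrite !mxE.
split=> // i.
  apply: f_component (homogeneous_P i) _ => e eE.
  by apply: Minj => j; rewrite eE dE.
apply: f_component (homogeneous_Pd i) _ => e eE.
by apply: Minj => j; rewrite eE dotNr dE ffunE.
Qed.

Lemma phi_f_O_exp i k : phi (f (O i) ^+ t) (fun=> 1) k = (lam i * q ^ dot (M i) k) ^+ t.
Proof.
rewrite rmorphXn /= fO phiZ phi_mono shiftopZ shiftopX /=.
by rewrite mulr1.
Qed.

Lemma phi_f_Oi_exp i k : phi (f (Oi i) ^+ t) (fun=> 1) k = (lam i * q ^ dot (M i) k) ^- t.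
Proof.
rewrite rmorphXn /= f_Oi phiZ phi_mono shiftopZ shiftopX /=.
by rewrite mulr1 dotNl -exprVn invfM invr_expz.
Qed.

(** The point 0 gives the condition on [c]; the point [eps l] then gives [q] to the power
    [2 t M_i(l)] equal to 1, which forces the exponent to be 0. *)
Lemma support_of_vanishing i j c : c != 0 ->
  (forall k : G, k j = 0 -> (c * q ^ dot (M i) k) ^+ t = (c * q ^ dot (M i) k) ^- t) ->
  c ^+ t = c ^- t /\ forall l, l != j -> M i l = 0.
Proof.
move=> c0 H; have H0 : c ^+ t = c ^- t.
  by move: (H 0); rewrite dot0r expr0z mulr1 ffunE; apply.
split=> // l lj; have := H (eps l); rewrite ffunE eq_sym (negPf lj) => /(_ erefl).
rewrite dot_epsr !exprMn invfM {1}H0.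
have ct : c ^- t != 0 by rewrite invr_eq0 expf_neq0.
move/(mulfI ct) => E.
have : q ^ (M i l *+ (t + t)) = 1.
  by rewrite q_expzMn exprD {2}E mulfV // expf_neq0 // expfz_neq0.
move/(q_expz_eq1 hq)/eqP; rewrite mulrn_eq0 addn_eq0 andbb.
by case: t ht => // t' _ /eqP.
Qed.

Variable d : 'I_n -> G.
Hypotheses (dE : forall i j, dot (M j) (d i) = eps i j)
  (dP : forall i, component (d i) (f (P i))) (dPd : forall i, component (- d i) (f (Pd i))).

(** According to the sign of [d i j], either [f (Pd i)] or [f (P i)] has a negative [j]-th degree.
    The product starting with it vanishes at [k j = 0]; evaluating its defining relation on the
    constant function 1 yields the equation, with the [q ^+ t] of [P i * Pd i] absorbed in [c]. *)
Lemma support_at i j : d i j != 0 -> exists c : K,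
  [/\ c = (if 0 < d i j then lam i else q * lam i), c ^+ t = c ^- t
    & forall l, l != j -> M i l = 0].
Proof.
move=> dij; exists (if 0 < d i j then lam i else q * lam i).
have c0 : (if 0 < d i j then lam i else q * lam i) != 0 by case: ifP; rewrite ?mulf_neq0.
have [] // := @support_of_vanishing i j _ c0 _ => k kj.
have qt0 : (q ^+ t - q ^- t)^-1 != 0 by rewrite invr_eq0 qt_neq0.
case: ifP => [dpos|dneg].
  have V := component_vanishing (phi (f (P i)) (fun=> 1)) (dPd i) (j := j) (k := k).
  have {}V : phi (f (Pd i) * f (P i)) (fun=> 1) k = 0.
    by rewrite phiM; apply: V => //; rewrite ffunE oppr_lt0.
  move: V; rewrite f_PdP phiZ phiB /= phi_f_O_exp phi_f_Oi_exp.
  by move=> /eqP; rewrite mulf_eq0 (negPf qt0) subr_eq0 => /eqP.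
have V := component_vanishing (phi (f (Pd i)) (fun=> 1)) (dP i) (j := j) (k := k).
have {}V : phi (f (P i) * f (Pd i)) (fun=> 1) k = 0.
  rewrite phiM; apply: V => //.
  by rewrite lt_neqAle dij leNgt dneg.
move: V; rewrite f_PPd phiZ phiB !phiZ /= phi_f_O_exp phi_f_Oi_exp => /eqP.
by rewrite mulf_eq0 (negPf qt0) subr_eq0 -invfM -!exprMn mulrA => /eqP.
Qed.

(** For [j] in the support of [d i], [M i] is supported at [j] alone, so duality reads
    [M i j * d i j = 1] and both are the same sign. A second index in the support of [d i] would
    make [M i j] zero. *)
Lemma exponents_eps i : exists j,
  [/\ M i = eps j, d i = eps j & lam i ^+ t = lam i ^- t] \/
  [/\ M i = - eps j, d i = - eps j & (q * lam i) ^+ t = (q * lam i) ^- t].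
Proof.
have /ffun_neq_ex[j] : d i != 0.
  by apply/eqP => d0; have := dE i i; rewrite d0 dot0r ffunE eqxx.
rewrite ffunE => dij; exists j.
have [c [cE ct Ml]] := support_at dij.
have MiE : M i j * d i j = 1.
  have := dE i i; rewrite /dot (bigD1 j) //= big1 ?addr0 => [|l lj].
    by rewrite ffunE eqxx => ->.
  by rewrite Ml ?mul0r.
have dl l : l != j -> d i l = 0.
  move=> lj; apply/eqP; apply: contraT => dil.
  have [_ [_ _ /(_ j)]] := support_at dil; rewrite eq_sym => /(_ lj) M0.
  by move: MiE; rewrite M0 mul0r.
have epsE (u : G) z : (forall l, l != j -> u l = 0) -> u j = z -> u = eps j *~ z.
  move=> ul uj; apply/ffunP => l; rewrite ffunMzE ffunE; case: eqP => [->|/eqP /ul->].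
    by rewrite uj mulrzz mul1r.
  by rewrite mul0rz.
have MdE : M i j = d i j.
  by have /orP[/eqP dE1|/eqP dE1] := intUnitRing.unitzPl MiE; move: MiE; rewrite dE1;
    rewrite ?mulr1 ?mulrN1 // => <-; rewrite opprK.
have /orP[/eqP dE1|/eqP dE1] := intUnitRing.unitzPl MiE; rewrite dE1 /= in cE MdE.
- left; rewrite -cE; split=> //.
    by rewrite (epsE (M i) 1).
  by rewrite (epsE (d i) 1).
- right; rewrite -cE; split=> //.
    by rewrite (epsE (M i) (-1)) ?mulrN1z.
  by rewrite (epsE (d i) (-1)) ?mulrN1z.
Qed.

(** For [M i = - eps j] the roles of [P j] and [Pd j] are exchanged, which accounts for a sign. The
    same [c] serves both products. *)
Lemma f_PPd_scale i : exists2 c : K, c != 0 &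
  f (P i) * f (Pd i) = c *: (ladder (d i) * ladder (- d i)) /\
  f (Pd i) * f (P i) = c *: (ladder (- d i) * ladder (d i)).
Proof.
have [j [[Mi di lt]|[Mi di lt]]] := exponents_eps i.
  exists (lam i ^+ t); first by rewrite expf_neq0.
  rewrite di f_PPd f_PdP fO f_Oi Mi mono_eps mono_Neps ladder_eps ladder_Neps.
  case: (relA j) => _ _ _ -> ->; rewrite !exprZn exprVn -lt; split.
    rewrite !scalerA ![_ * lam i ^+ t]mulrC -!scalerA -scalerBr !scalerA.
    by rewrite [_ * lam i ^+ t]mulrC.
  by rewrite -scalerBr !scalerA mulrC.
(* Here [w] is its own inverse, so the t-th powers of [lam i] and of its inverse are [w * q ^- t]
   and [w * q ^+ t]. *)
set w := (q * lam i) ^+ t.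
have w0 : w != 0 by rewrite expf_neq0 // mulf_neq0.
have qt0 : q ^+ t != 0 by rewrite expf_neq0.
have lamE : lam i ^+ t = w * q ^- t by rewrite /w exprMn mulrC mulKf.
have lamVE : (lam i)^-1 ^+ t = w * q ^+ t.
  by rewrite /w lt exprVn exprMn invfM mulrC mulVKf.
exists (- w); first by rewrite oppr_eq0.
rewrite di opprK f_PPd f_PdP fO f_Oi Mi opprK mono_eps mono_Neps ladder_eps ladder_Neps.
case: (relA j) => _ _ _ -> ->; rewrite !exprZn lamE lamVE.
have swap (a b c c' : K) (y z : A) : a = w * c -> b = w * c' ->
    (q ^+ t - q ^- t)^-1 *: (a *: z - b *: y) =
    (- w) *: ((q ^+ t - q ^- t)^-1 *: (c' *: y - c *: z)).
  move=> -> ->; rewrite -!scalerA -scalerBr scalerA [_ * w]mulrC -scalerA.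
  by rewrite scaleNr -[in RHS]scalerN -[in RHS]scalerN opprB.
split; last exact: swap.
rewrite -[O j ^+ t in RHS]scale1r -[Oi j ^+ t in RHS]scale1r.
rewrite [q ^+ t *: (_ *: _)]scalerA [q ^- t *: (_ *: _)]scalerA.
by rewrite (swap _ _ 1 1) // mulr1 mulrCA ?mulfV ?mulVf ?mulr1.
Qed.

(** The range is a subalgebra. Up to sign the exponents permute the unit vectors, so it contains
    every [O j] and [Oi j]; dividing [f (P i)] and [f (Pd i)] by their coefficients, which are
    units, yields every [P j] and [Pd j]. *)
Lemma f_surj x : exists y, f y = x.
Proof.
pose R x := exists y, f y = x.
have RM x1 x2 : R x1 -> R x2 -> R (x1 * x2).
  by move=> [y1 <-] [y2 <-]; exists (y1 * y2); rewrite fM.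
have RZ c x1 : R x1 -> R (c *: x1).
  by move=> [y1 <-]; exists (c *: y1); rewrite fZ.
have R1 : R 1 by exists 1; rewrite rmorph1.
have Rf y : R (f y) by exists y.
have scaleK c u : c != 0 -> R (c *: u) -> R u.
  by move=> c0 /(RZ c^-1); rewrite scalerA mulVf // scale1r.
have [p pE] := choice exponents_eps.
(* If [p i = p i'], then [M i'] and [d i] are the same unit vector up to sign and pair to a nonzero
   integer, so [i = i'] by duality. *)
have p_inj : injective p.
  move=> i i' E; apply/esym/eqP.
  have : dot (M i') (d i) != 0.
    have := pE i; have := pE i'; rewrite E.
    by move=> [[-> _ _]|[-> _ _]] [[_ -> _]|[_ -> _]];
      rewrite ?dotNl ?dotNr dot_epsl ?ffunE eqxx.
  by rewrite dE ffunE; case: (i' == i).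
have onto j : exists i, p i = j by exists (invF p_inj j); apply: f_invF.
have ROOi j : R (O j) /\ R (Oi j).
  have [i pij] := onto j; have Ri := Rf (O i); have Ri' := Rf (Oi i).
  rewrite f_Oi in Ri'; rewrite fO in Ri.
  move/scaleK: Ri' => /(_ (invr_neq0 (lam0 i))); move/scaleK: Ri => /(_ (lam0 i)).
  have := pE i; rewrite pij.
  by move=> [[-> _ _]|[-> _ _]]; rewrite ?opprK mono_eps mono_Neps.
have Rmono a : R (mono a).
  elim/ffun_eps_ind: a => [|i a IH|i a IH]; first by rewrite mono0.
    by rewrite mono_epsD; apply: RM IH; case: (ROOi i).
  by rewrite mono_epsB; apply: RM IH; case: (ROOi i).
have ladder_neq0 e e' : ladder e * ladder e' != 0.
  apply/eqP => /Hn_domain[] E; [have := phi_ladder_neq0 e|have := phi_ladder_neq0 e'];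
    by rewrite E rmorph0 eqxx.
have Runit u (c : K) z : c != 0 -> R (c *: mono u * z) -> R z.
  move=> c0; rewrite -scalerAl => /(scaleK _ _ c0) /(RM _ _ (Rmono (- u))).
  by rewrite mulrA monoVl mul1r.
have Rladder i : R (ladder (d i)) /\ R (ladder (- d i)).
  have [c c0 [E E']] := f_PPd_scale i.
  have [a La aE] := dP i; have [b Lb bE] := dPd i; rewrite aE bE in E E'.
  have [u [c1 c10 aM]] :=
    laurent_factor_unit La Lb (homogeneous_ladder _) (ladder_neq0 _ _) c0 E.
  have [v [c2 c20 bM]] :=
    laurent_factor_unit Lb La (homogeneous_ladder _) (ladder_neq0 _ _) c0 E'.
  split.
    by apply: (Runit u c1) => //; rewrite -aM -aE; apply: Rf.
  by apply: (Runit v c2) => //; rewrite -bM -bE; apply: Rf.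
move: x; apply: (Hn_tensor_ind hA) => // [c x1 x2 Rx1 [y2 <-]|j].
  by have [y1 <-] := RZ c _ Rx1; exists (y1 + y2); rewrite rmorphD.
have [RO ROi] := ROOi j; have [i pij] := onto j.
have [] := Rladder i; have := pE i; rewrite pij.
by move=> [[_ -> _]|[_ -> _]]; rewrite ?opprK ladder_eps ladder_Neps.
Qed.

End Exponents.

Lemma f_bijective : bijective f.
Proof.
have [M [lam ME]] := f_O_mono.
have lam0 i : lam i != 0 by case: (ME i).
have fO i : f (O i) = lam i *: mono (M i) by case: (ME i).
have [d [dE dP dPd]] := dual_exponents lam0 fO.
have [g fK] := choice (f_surj lam0 fO dE dP dPd).
by exists g => // x; apply: f_inj; rewrite fK.
Qed.

End Endomorphism.

End Faithful.

End Structure.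

(** * Conclusion, with the representation supplied by the universal property *)

Theorem theorem1p4 (K : fieldType) (q : K) (t n : nat)
    (ht : (1 <= t)%N) (hn : (1 <= n)%N)
    (hq0 : q != 0) (hq : not_root_of_unity q)
    (A : algType K) (O Oi P Pd : 'I_n -> A)
    (hA : is_Hn_tensor q t O Oi P Pd)
    (f : {lrmorphism A -> A}) :
  bijective f.
Proof.
have [[phi phiE] _] := proj2 hA _ _ _ _ _ (rep_rels t n hq0).
exact: f_bijective hq0 hq ht hA phi phiE f.
Qed.
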